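(* Let $A$ be a commutative ring, $n\geq 1$, and let $\phi:\mathcal L^n(A)\to\mathcal L^n(A)$ be a continuous homomorphism of $A$-algebras which is invertible (i.e. has a two-sided inverse which is also a continuous homomorphism of $A$-algebras). Then for any differential form $\omega\in\widetilde\Omega^n_{\mathcal L^n(A)}$, we have $$\mathrm{res}\big(\phi(\omega)\big)=\mathrm{res}(\omega).$$
   Context: Rings are commutative, associative and unital. For $n\geq 1$, $\mathcal L^n(A)=A((t_1))\ldots((t_n))$ is the ring of iterated Laurent series (inductively $\mathcal L^1(A)=A((t_1))$, $\mathcal L^n(A)=\mathcal L^{n-1}(A)((t_n))$). Elements are written $f=\sum_{l\in\mathbb Z^n}a_lt^l$ with $t^l=t_1^{l_1}\cdots t_n^{l_n}$, and $\mathrm{supp}(f)=\{l: a_l\neq 0\}$. Put $\Lambda_1=\mathbb Z$, $\mathbb Z^1_\lambda=\{l\in\mathbb Z: l\geq\lambda\}$, and for $n\geq 2$ put $\Lambda_n=\mathrm{Map}(\mathbb Z,\Lambda_{n-1})\times\mathbb Z$ and $\mathbb Z^n_\lambda=\bigcup_{l_n\geq\lambda_n}\mathbb Z^{n-1}_{\lambda'(l_n)}\times\{l_n\}$ for $\lambda=(\lambda',\lambda_n)\in\Lambda_n$. A formal series lies in $\mathcal L^n(A)$ iff its support is contained in $\mathbb Z^n_\lambda$ for some $\lambda\in\Lambda_n$. Topology: $\mathcal L^n(A)$ is an additive topological group with a base of open neighborhoods of zero given by the $A$-submodules $U_\lambda=\{f:\mathrm{supp}(f)\cap(-\mathbb Z^n_\lambda)=\varnothing\}$,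 $\lambda\in\Lambda_n$. $\widetilde\Omega^1_{\mathcal L^n(A)}$ is the quotient of the module of absolute Kähler differentials of $\mathcal L^n(A)$ by the $\mathcal L^n(A)$-submodule generated by all $df-\sum_{i=1}^n\frac{\partial f}{\partial t_i}dt_i$; it is free of rank $n$ with basis $dt_1,\ldots,dt_n$. $\widetilde\Omega^n_{\mathcal L^n(A)}=\bigwedge^n_{\mathcal L^n(A)}\widetilde\Omega^1_{\mathcal L^n(A)}$. The residue map $\mathrm{res}:\widetilde\Omega^n_{\mathcal L^n(A)}\to A$ is the $A$-linear map $\sum_l a_lt^l\,dt_1\wedge\ldots\wedge dt_n\mapsto a_{-1\ldots-1}$. $\phi$ also denotes the induced additive map $\widetilde\Omega^n_{\mathcal L^n(A)}\to\widetilde\Omega^n_{\mathcal L^n(A)}$, $f\,dt_1\wedge\ldots\wedge dt_n\mapsto\phi(f)\,d\phi(t_1)\wedge\ldots\wedge d\phi(t_n)$. *)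

(* Defs.v *)
From HB Require Import structures.
From mathcomp Require Import all_boot all_order all_algebra.
From mathcomp Require Import perm.
From mathcomp Require Import all_classical.
From mathcomp Require Import topology_structure.
From mathcomp Require Import zify.

Set Implicit Arguments.
Unset Strict Implicit.
Unset Printing Implicit Defensive.
Import Order.TTheory GRing.Theory Num.Theory.

Local Open Scope classical_set_scope.
Local Open Scope ring_scope.

(* Rings are [comPzRingType]s, so the zero ring is allowed. *)

Section LaurentType.
Variable A : comPzRingType.

Definition laurent_pred : {pred int -> A} :=
  fun f => `[< exists N : int, forall i, i < N -> f i = 0 >].

Record laurent : Type := Laurent {
  lcoef :> int -> A;
  lcoefP : lcoef \in laurent_pred }.

HB.instance Definition _ := [isSub for lcoef].
HB.instance Definition _ := [Choice of laurent by <:].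

Lemma laurent_predP (f : int -> A) :
  reflect (exists N : int, forall i, i < N -> f i = 0) (f \in laurent_pred).
Proof. exact: asboolP. Qed.

Lemma laurent_zmod_closed : zmod_closed laurent_pred.
Proof.
split=> [|f g /laurent_predP[M fM] /laurent_predP[N gN]]; apply/laurent_predP.
  by exists 0.
exists (Num.min M N) => i; rewrite lt_min => /andP[iM iN].
have -> : (f - g) i = f i - g i by [].
by rewrite fM// gN// subr0.
Qed.

HB.instance Definition _ :=
  GRing.isZmodClosed.Build (int -> A) laurent_pred laurent_zmod_closed.
HB.instance Definition _ := [SubChoice_isSubZmodule of laurent by <:].

End LaurentType.

Section LaurentRing.
Variable A : comPzRingType.
Implicit Types (f g h : laurent A) (i j k : int).

Lemma laurent_bound f : exists N : int, forall i, i < N -> f i = 0.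
Proof. exact/laurent_predP/lcoefP. Qed.

Lemma laurentP f g : (forall i, f i = g i) -> f = g.
Proof. by move=> fg; apply/val_inj/funext. Qed.

Lemma lcoef0 i : (0 : laurent A) i = 0. Proof. by []. Qed.
Lemma lcoefD f g i : (f + g) i = f i + g i. Proof. by []. Qed.
Lemma lcoefN f i : (- f) i = - f i. Proof. by []. Qed.

(* The Cauchy product; for Laurent series the sum has finite support. *)
Definition lconv (f g : int -> A) (k : int) : A :=
  \sum_(i \in [set: int]) f i * g (k - i).

Lemma lconvE (f g : int -> A) k (s : seq int) : uniq s ->
  (forall i, i \notin s -> f i * g (k - i) = 0) ->
  lconv f g k = \sum_(i <- s) f i * g (k - i).
Proof.
move=> us sfg; rewrite (fsbig_seq _ _ us); apply/esym/fsbig_widen => //.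
by move=> i [_ /= /negP is_]; exact: sfg.
Qed.

Let itv (a b : int) : seq int := [seq a + x%:Z | x <- iota 0 `|b - a + 1|].

Let itv_uniq a b : uniq (itv a b).
Proof. by rewrite map_inj_uniq ?iota_uniq// => x y; lia. Qed.

Let itvP a b i : i \notin itv a b -> i < a \/ b < i.
Proof.
move=> iab; have [ia|ai] := ltP i a; [by left | right].
rewrite ltNge; apply: contra iab => ib; apply/mapP; exists `|(i - a)%R|%N.
  by rewrite mem_iota; lia.
lia.
Qed.

Let itv_ge a b i : i \in itv a b -> a <= i.
Proof. by move=> /mapP[j _ ->]; lia. Qed.

Let mul0 (f g : int -> A) (a b i j : int) :
  (forall i, i < a -> f i = 0) -> (forall i, i < b -> g i = 0) ->
  i < a \/ j < b -> f i * g j = 0.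
Proof. by move=> fa gb [/fa|/gb] ->; rewrite ?mul0r ?mulr0. Qed.

Let lconv_lt (f g : int -> A) (a b k : int) :
  (forall i, i < a -> f i = 0) -> (forall i, i < b -> g i = 0) ->
  k < a + b -> lconv f g k = 0.
Proof.
move=> fa gb kab; rewrite (@lconvE _ _ _ [::]) ?big_nil// => i _.
by apply: mul0 fa gb _; lia.
Qed.

Let lconv_itv (f g : int -> A) (a b k : int) :
  (forall i, i < a -> f i = 0) -> (forall i, i < b -> g i = 0) ->
  lconv f g k = \sum_(i <- itv a (k - b)) f i * g (k - i).
Proof.
move=> fa gb; apply: lconvE => // i /itvP iab.
by apply: mul0 fa gb _; lia.
Qed.

Lemma lconv_subproof f g : lconv f g \in @laurent_pred A.
Proof.
have [a fa] := laurent_bound f; have [b gb] := laurent_bound g.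
by apply/laurent_predP; exists (a + b) => k; exact: lconv_lt.
Qed.

Definition lmul f g : laurent A := Laurent (lconv_subproof f g).

Lemma lmulC : commutative lmul.
Proof.
move=> f g; have [a fa] := laurent_bound f; have [b gb] := laurent_bound g.
apply: laurentP => k /=; rewrite (lconv_itv k fa gb).
rewrite (@lconvE g f k [seq k - i | i <- itv a (k - b)]).
- by rewrite [RHS]big_map; apply: eq_bigr => i _; rewrite subKr mulrC.
- by rewrite map_inj_uniq// => i j; lia.
move=> i iS; have /itvP kiS : k - i \notin itv a (k - b).
  by apply: contra iS => kiS; apply/mapP; exists (k - i); [|lia].
by apply: mul0 gb fa _; lia.
Qed.

Lemma lmulA : associative lmul.
Proof.
move=> f g h; apply: laurentP => k /=.
have [a fa] := laurent_bound f; have [b gb] := laurent_bound g.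
have [c hc] := laurent_bound h.
have fgab i : i < a + b -> lconv f g i = 0 by exact: lconv_lt.
have ghbc i : i < b + c -> lconv g h i = 0 by exact: lconv_lt.
rewrite (lconv_itv k fa ghbc) (lconv_itv k fgab hc).
set S1 := itv (a + b) _; set S2 := itv a _.
transitivity (\sum_(j <- S2) \sum_(i <- S1) f j * g (i - j) * h (k - i)).
  rewrite big_seq_cond [RHS]big_seq_cond; apply: eq_bigr => j.
  rewrite andbT => /itv_ge aj.
  rewrite (@lconvE _ h _ [seq i - j | i <- S1]).
  - rewrite [in LHS]big_map mulr_sumr; apply: eq_bigr => i _.
    by rewrite mulrA opprB addrA subrK.
  - by rewrite map_inj_uniq ?itv_uniq// => x y; lia.
  move=> i iS; have /itvP ijS : i + j \notin S1.
    by apply: contra iS => ijS; apply/mapP; exists (i + j); rewrite ?addrK.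
  by apply: mul0 gb hc _; lia.
rewrite exchange_big /=; apply: eq_bigr => i _.
have [hi|] := ltP (k - i) c.
  by rewrite hc// mulr0 big1// => j _; rewrite mulr0.
move=> ik; rewrite (@lconvE f g _ S2) ?itv_uniq ?mulr_suml// => j /itvP jS.
by apply: mul0 fa gb _; lia.
Qed.

Lemma lmulDl : left_distributive lmul +%R.
Proof.
move=> f g h; have [a fa] := laurent_bound f; have [b gb] := laurent_bound g.
have [c hc] := laurent_bound h; apply: laurentP => k.
pose m : int := Num.min a b.
have fm i : i < m -> f i = 0 by rewrite lt_min => /andP[/fa].
have gm i : i < m -> g i = 0 by rewrite lt_min => /andP[_ /gb].
have fgm i : i < m -> (f + g) i = 0 by move=> im; rewrite lcoefD fm// gm// addr0.
rewrite lcoefD [LHS](lconv_itv k fgm hc).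
rewrite [X in _ = X + _](lconv_itv k fm hc) [X in _ = _ + X](lconv_itv k gm hc).
by rewrite -big_split; apply: eq_bigr => i _; rewrite lcoefD mulrDl.
Qed.

Lemma lmono_subproof (a : A) (m : int) :
  (fun i : int => if i == m then a else 0) \in @laurent_pred A.
Proof. by apply/laurent_predP; exists m => i; case: eqVneq => // ->; lia. Qed.

(* [lmono a m] is the monomial a t^m. *)
Definition lmono (a : A) (m : int) : laurent A := Laurent (lmono_subproof a m).

Lemma lconv_mono a m (g : int -> A) k :
  lconv (lmono a m) g k = a * g (k - m).
Proof.
rewrite (@lconvE _ _ _ [:: m])//= ?big_seq1 ?eqxx// => i.
by rewrite inE => /negPf->; rewrite mul0r.
Qed.

Lemma lmul1 : left_id (lmono 1 0) lmul.
Proof. by move=> f; apply: laurentP => k /=; rewrite lconv_mono mul1r subr0. Qed.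

HB.instance Definition _ :=
  GRing.Zmodule_isComPzRing.Build (laurent A) lmulA lmulC lmul1 lmulDl.

Lemma lcoefM f g k : (f * g) k = \sum_(i \in [set: int]) f i * g (k - i).
Proof. by []. Qed.

Lemma lcoefME f g k (s : seq int) : uniq s ->
  (forall i, i \notin s -> f i * g (k - i) = 0) ->
  (f * g) k = \sum_(i <- s) f i * g (k - i).
Proof. exact: lconvE. Qed.

Lemma lcoefM_range (a b k : int) : exists2 s : seq int, uniq s &
  forall i, i \notin s -> i < a \/ k - i < b.
Proof. by exists (itv a (k - b)) => // i /itvP; lia. Qed.

Lemma lcoef1 k : (1 : laurent A) k = if k == 0 then 1 else 0.
Proof. by []. Qed.

Lemma lmonoM a m g k : (lmono a m * g) k = a * g (k - m).
Proof. exact: lconv_mono. Qed.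

Definition lconst (a : A) : laurent A := lmono a 0.

Lemma lconst_zmod : zmod_morphism lconst.
Proof.
move=> a b; apply: laurentP => k.
by rewrite lcoefD lcoefN /=; case: ifP => // _; rewrite subr0.
Qed.

Lemma lconst_monoid : monoid_morphism lconst.
Proof.
split=> // a b; apply: laurentP => k; rewrite lmonoM /= subr0.
by case: ifP => // _; rewrite mulr0.
Qed.

HB.instance Definition _ := GRing.isZmodMorphism.Build _ _ lconst lconst_zmod.
HB.instance Definition _ := GRing.isMonoidMorphism.Build _ _ lconst lconst_monoid.

End LaurentRing.

Section Derivations.

Lemma lmap_subproof (A B : comPzRingType) (D : {additive A -> B})
  (f : laurent A) : D \o f \in @laurent_pred B.
Proof.
have [N fN] := laurent_bound f; apply/laurent_predP; exists N => i iN /=.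
by rewrite fN// raddf0.
Qed.

Definition lmap (A B : comPzRingType) (D : {additive A -> B}) (f : laurent A) :
  laurent B := Laurent (lmap_subproof D f).

Lemma lmap_zmod (A B : comPzRingType) (D : {additive A -> B}) :
  zmod_morphism (lmap D).
Proof. by move=> f g; apply: laurentP => k; exact: (raddfB D). Qed.

HB.instance Definition _ (A B : comPzRingType) (D : {additive A -> B}) :=
  GRing.isZmodMorphism.Build _ _ (lmap D) (lmap_zmod D).

Variable A : comPzRingType.
Implicit Types f g : laurent A.

Lemma lderiv_subproof f :
  (fun k : int => f (k + 1) *~ (k + 1)) \in @laurent_pred A.
Proof.
have [N fN] := laurent_bound f; apply/laurent_predP; exists (N - 1) => i iN.
by rewrite fN ?mul0rz//; lia.
Qed.

(* the derivative with respect to the variable of [laurent A] *)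
Definition lderiv f : laurent A := Laurent (lderiv_subproof f).

Lemma lderiv_zmod : zmod_morphism lderiv.
Proof.
by move=> f g; apply: laurentP => k; exact: (mulrzBl (f (k + 1)) (g (k + 1))).
Qed.

HB.instance Definition _ := GRing.isZmodMorphism.Build _ _ lderiv lderiv_zmod.

Lemma lmap_leibniz (D : {additive A -> A}) :
  (forall x y, D (x * y) = x * D y + y * D x) ->
  forall f g, lmap D (f * g) = f * lmap D g + g * lmap D f.
Proof.
move=> DM f g; apply: laurentP => k.
have [a fa] := laurent_bound f; have [b gb] := laurent_bound g.
have [s us sP] := lcoefM_range a b k.
have E (F G : laurent A) : (forall i, i < a -> F i = 0) ->
    (forall i, i < b -> G i = 0) -> (F * G) k = \sum_(i <- s) F i * G (k - i).
  move=> Fa Gb; apply: lcoefME => // i /sP[/Fa|/Gb] ->.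
    by rewrite mul0r.
  by rewrite mulr0.
have -> : lmap D (f * g) k = D ((f * g) k) by [].
rewrite lcoefD [g * _]mulrC !E// => [|i ia|i ib]; last 2 first.
- by rewrite /= fa ?raddf0.
- by rewrite /= gb ?raddf0.
rewrite raddf_sum -big_split; apply: eq_bigr => i _ /=.
by rewrite DM [g _ * _]mulrC.
Qed.

Lemma lderiv_leibniz f g : lderiv (f * g) = f * lderiv g + g * lderiv f.
Proof.
apply: laurentP => k.
have [a fa] := laurent_bound f; have [b gb] := laurent_bound g.
have [s us sP] := lcoefM_range a b (k + 1).
have -> : lderiv (f * g) k = (f * g) (k + 1) *~ (k + 1) by [].
rewrite lcoefD [g * _]mulrC (@lcoefME _ f g _ s)//; last first.
  by move=> i /sP[/fa|/gb] ->; rewrite ?mul0r ?mulr0.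
rewrite (@lcoefME _ f (lderiv g) _ s)//; last first.
  move=> i /sP[/fa->|]; first by rewrite mul0r.
  rewrite /=; have -> : k - i + 1 = k + 1 - i by lia.
  by move=> /gb->; rewrite mul0rz mulr0.
rewrite (@lcoefME _ (lderiv f) g _ [seq i - 1 | i <- s]); last 2 first.
- by rewrite map_inj_uniq// => x y; lia.
- move=> i iS; have : i + 1 \notin s.
    by apply: contra iS => iS; apply/mapP; exists (i + 1); rewrite ?addrK.
  move=> /sP[/fa /= ->|]; first by rewrite mul0rz mul0r.
  have -> : k + 1 - (i + 1) = k - i by lia.
  by move=> /gb->; rewrite mulr0.
rewrite big_map mulrz_suml -big_split; apply: eq_bigr => i _ /=.
have -> : k - i + 1 = k + 1 - i by lia.
have -> : k - (i - 1) = k + 1 - i by lia.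
rewrite subrK.
by rewrite mulrzAr mulrzAl -mulrzDr; congr (_ *~ _); lia.
Qed.

End Derivations.

Section Iterated.
Variable A : comPzRingType.

Fixpoint iterL (n : nat) : comPzRingType :=
  if n is m.+1 then laurent (iterL m) else A.

Fixpoint iconst_ (n : nat) : {rmorphism A -> iterL n} :=
  match n return {rmorphism A -> iterL n} with
  | 0 => idfun
  | m.+1 => @lconst (iterL m) \o iconst_ m
  end.

(* The variable of [iterL m.+1] over [iterL m] has index [ord_max]. *)
Fixpoint ivar_ (n : nat) : 'I_n -> iterL n :=
  match n return 'I_n -> iterL n with
  | 0 => fun=> 0
  | m.+1 => fun i => if unlift ord_max i is Some j then lconst (ivar_ j)
                     else lmono 1 1
  end.

Fixpoint ideriv_ (n : nat) : 'I_n -> {additive iterL n -> iterL n} :=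
  match n return 'I_n -> {additive iterL n -> iterL n} with
  | 0 => fun=> idfun
  | m.+1 => fun i => if unlift ord_max i is Some j then lmap (ideriv_ j)
                     else @lderiv (iterL m)
  end.

Fixpoint icoef_ (n : nat) : iterL n -> 'rV[int]_n -> A :=
  match n return iterL n -> 'rV[int]_n -> A with
  | 0 => fun f _ => f
  | m.+1 => fun f l => icoef_ (f (l 0 ord_max)) (col' ord_max l)
  end.

Lemma ideriv_leibniz_ n (i : 'I_n) (f g : iterL n) :
  ideriv_ i (f * g) = f * ideriv_ i g + g * ideriv_ i f.
Proof.
elim: n i f g => [[]//|n IHn] i f g /=; case: unliftP => [j _|_].
  exact: lmap_leibniz.
exact: lderiv_leibniz.
Qed.

Lemma ideriv1_ n (i : 'I_n) : ideriv_ i 1 = 0.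
Proof.
have := ideriv_leibniz_ i 1 1; rewrite !mul1r => /eqP.
by rewrite -subr_eq subrr eq_sym => /eqP.
Qed.

Lemma ideriv_var_ n (i j : 'I_n) : ideriv_ i (ivar_ j) = (i == j)%:R.
Proof.
elim: n i j => [[]//|n IHn] i j /=.
case: (unliftP ord_max i) => [i' ->|->]; case: (unliftP ord_max j) => [j' ->|->].
- rewrite (inj_eq (lift_inj)) -(rmorph_nat (@lconst _)) -IHn.
  by apply: laurentP => k /=; case: ifP => // _; rewrite raddf0.
- rewrite eq_sym (negPf (neq_lift _ _)); apply: laurentP => k /=.
  by case: ifP => _; rewrite ?raddf0 ?ideriv1_.
- rewrite (negPf (neq_lift _ _)); apply: laurentP => k /=.
  by case: eqVneq => [->|_]; rewrite ?mulr0z ?mul0rz.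
- rewrite eqxx; apply: laurentP => k; rewrite [RHS]lcoef1 /=.
  by rewrite -subr_eq0 addrK; case: eqP => [->|]; rewrite ?mul0rz.
Qed.

Lemma icoefB_ n (f g : iterL n) l : icoef_ (f - g) l = icoef_ f l - icoef_ g l.
Proof. by elim: n f g l => [//|n IHn] f g l /=; rewrite -IHn. Qed.

Lemma icoef_inj_ n (f g : iterL n) : (forall l, icoef_ f l = icoef_ g l) -> f = g.
Proof.
elim: n f g => [|n IHn] f g fg; first exact: (fg 0).
apply: laurentP => k; apply: IHn => l.
pose l' : 'rV[int]_n.+1 :=
  \row_i (if unlift ord_max i is Some j then l 0 j else k).
have := fg l'; rewrite /= mxE unlift_none.
suff -> : col' ord_max l' = l by [].
by apply/rowP => j; rewrite !mxE liftK.
Qed.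

End Iterated.

Section Lambda.

(* $\Lambda_n$ and $\mathbb Z^n_\lambda$, with multi-indices as row vectors.
   $\Lambda_0$ is a singleton, hence $\Lambda_1$ is a copy of $\mathbb Z$. *)
Fixpoint Lambda (n : nat) : Type :=
  if n is m.+1 then ((int -> Lambda m) * int)%type else unit.

Fixpoint Zlam (n : nat) : Lambda n -> set 'rV[int]_n :=
  match n return Lambda n -> set 'rV[int]_n with
  | 0 => fun=> setT
  | m.+1 => fun lam => [set l : 'rV[int]_m.+1 | lam.2 <= l 0 ord_max /\
                          Zlam (lam.1 (l 0 ord_max)) (col' ord_max l)]
  end.

Lemma Lambda_inh n : inhabited (Lambda n).
Proof. by elim: n => [|n [x]]; constructor; [exact: tt | exact: (fun=> x, 0)]. Qed.

Lemma ZlamU n (lam mu : Lambda n) :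
  exists nu, Zlam lam `|` Zlam mu `<=` Zlam nu.
Proof.
elim: n lam mu => [|n IHn] lam mu; first by exists tt.
have [h hP] := choice (fun k : int => IHn (lam.1 k) (mu.1 k)).
exists (h, Num.min lam.2 mu.2) => l /= [[l1 l2]|[l1 l2]]; split.
- by rewrite ge_min l1.
- by apply: hP; left.
- by rewrite ge_min l1 orbT.
- by apply: hP; right.
Qed.

(* A formal series is (the coefficient family of) an iterated Laurent series
   iff its support is contained in some [Zlam lam]. *)
Lemma iterL_support_ (A : comPzRingType) n (F : 'rV[int]_n -> A) :
  (exists f : iterL A n, icoef_ f = F) <->
  (exists lam : Lambda n, [set l | F l != 0] `<=` Zlam lam).
Proof.
elim: n F => [|n IHn] F.
  split=> _; first by exists tt.
  by exists (F 0); apply/funext => l; rewrite [l]thinmx0.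
pose cons (k : int) (l : 'rV[int]_n) : 'rV[int]_n.+1 :=
  \row_i (if unlift ord_max i is Some j then l 0 j else k).
have cons0 k l : cons k l 0 ord_max = k by rewrite mxE unlift_none.
have consC k l : col' ord_max (cons k l) = l.
  by apply/rowP => j; rewrite !mxE liftK.
have consK (l : 'rV[int]_n.+1) : cons (l 0 ord_max) (col' ord_max l) = l.
  by apply/rowP => i; rewrite mxE; case: unliftP => [j ->|->]; rewrite ?mxE.
split=> [[f fF]|[lam lamP]].
  have [N fN] := laurent_bound f.
  have /choice[h hP] k : exists lam : Lambda n,
      [set l | icoef_ (f k) l != 0] `<=` Zlam lam.
    by apply/IHn; exists (f k).
  exists (h, N) => l /=; rewrite -fF /= => fl; split; last exact: hP.
  rewrite leNgt; apply: contra fl => /fN ->; apply/eqP.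
  by have := icoefB_ (0 : iterL A n) 0 (col' ord_max l); rewrite !subrr.
have /choice[f fP] k : exists f : iterL A n, icoef_ f = F \o cons k.
  apply/IHn; exists (lam.1 k) => l /= /lamP /= [_].
  by rewrite cons0 consC.
have f_laurent : f \in @laurent_pred (iterL A n).
  apply/laurent_predP; exists lam.2 => k kN; apply: icoef_inj_ => l.
  have := icoefB_ (0 : iterL A n) 0 l; rewrite !subrr => ->; rewrite fP /=.
  apply/eqP; apply: contraT => /lamP /= [+ _].
  by rewrite cons0 leNgt kN.
exists (Laurent f_laurent); apply/funext => l /=.
by rewrite fP /= consK.
Qed.

End Lambda.

(* $\mathcal L^n(A)=A((t_1))\ldots((t_n))$; the index i : 'I_n stands for
   $t_{i+1}$.  [ilaurent] is an alias of [iterL] on which the topology is put. *)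
Definition ilaurent (n : nat) (A : comPzRingType) : Type := iterL A n.

HB.instance Definition _ n A := GRing.ComPzRing.copy (ilaurent n A) (iterL A n).

Section IteratedLaurent.
Variables (n : nat) (A : comPzRingType).
Implicit Types (f g : ilaurent n A) (i j : 'I_n) (l : 'rV[int]_n).

Definition iconst (a : A) : ilaurent n A := iconst_ A n a.
HB.instance Definition _ := GRing.RMorphism.copy iconst (iconst_ A n).

Definition ivar i : ilaurent n A := ivar_ A i.

Definition ideriv i : ilaurent n A -> ilaurent n A := ideriv_ A i.
HB.instance Definition _ i := GRing.Additive.copy (ideriv i) (ideriv_ A i).

Definition icoef f l : A := icoef_ f l.

Lemma ideriv_leibniz i f g : ideriv i (f * g) = f * ideriv i g + g * ideriv i f.
Proof. exact: ideriv_leibniz_. Qed.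

Lemma ideriv_var i j : ideriv i (ivar j) = (i == j)%:R.
Proof. exact: ideriv_var_. Qed.

Lemma icoef0 l : icoef 0 l = 0.
Proof. by rewrite -[0](subrr 0) [LHS]icoefB_ subrr. Qed.

Lemma icoefN f l : icoef (- f) l = - icoef f l.
Proof. by rewrite -sub0r [LHS]icoefB_ [X in X - _]icoef0 sub0r. Qed.

Lemma icoefD f g l : icoef (f + g) l = icoef f l + icoef g l.
Proof. by rewrite -[g in LHS]opprK [LHS]icoefB_ [icoef_ (- g) _]icoefN opprK. Qed.

Lemma icoef_inj f g : (forall l, icoef f l = icoef g l) -> f = g.
Proof. exact: icoef_inj_. Qed.

(* The structure of $A$-algebra.  Algebra structures of the library require a
   nonzero ring, so only the module structure is registered: the maps of
   $A$-algebras are the ring morphisms which are [scalable]. *)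
Definition iscale (a : A) f : ilaurent n A := iconst a * f.

Fact iscaleA a b f : iscale a (iscale b f) = iscale (a * b) f.
Proof. by rewrite /iscale mulrA -rmorphM. Qed.
Fact iscale1 : left_id 1 iscale.
Proof. by move=> f; rewrite /iscale rmorph1 mul1r. Qed.
Fact iscaleDr : right_distributive iscale +%R.
Proof. by move=> a f g; rewrite /iscale mulrDr. Qed.
Fact iscaleDl f : {morph iscale^~ f : a b / a + b}.
Proof. by move=> a b; rewrite /iscale rmorphD mulrDl. Qed.

HB.instance Definition _ := GRing.Zmodule_isLmodule.Build A (ilaurent n A)
  iscaleA iscale1 iscaleDr iscaleDl.

Definition isupp f : set 'rV[int]_n := [set l | icoef f l != 0].

Definition Ulam (lam : Lambda n) : set (ilaurent n A) :=
  [set f | isupp f `&` [set - l | l in Zlam lam] = set0].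

Lemma ilaurent_support (F : 'rV[int]_n -> A) :
  (exists f, icoef f = F) <->
  (exists lam : Lambda n, [set l | F l != 0] `<=` Zlam lam).
Proof. exact: iterL_support_. Qed.

Lemma UlamP lam f :
  Ulam lam f <-> forall l, Zlam lam l -> icoef f (- l) = 0.
Proof.
split=> [fU l lZ|f0]; last first.
  apply/seteqP; split=> // m [fm [l lZ lm]]; move: fm.
  by rewrite /isupp /= -lm f0 ?eqxx.
apply/eqP/negP => /negP fl.
suff : (set0 : set 'rV[int]_n) (- l) by [].
by rewrite -fU; split=> //; exists l.
Qed.

Lemma Ulam0 lam : Ulam lam 0.
Proof. by apply/UlamP => l _; rewrite icoef0. Qed.

Lemma UlamD lam f g : Ulam lam f -> Ulam lam g -> Ulam lam (f + g).
Proof.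
move=> /UlamP fU /UlamP gU; apply/UlamP => l lZ.
by rewrite icoefD fU// gU// addr0.
Qed.

Lemma Ulam_sub lam mu : Zlam lam `<=` Zlam mu -> Ulam mu `<=` Ulam lam.
Proof. by move=> lm f /UlamP fU; apply/UlamP => l /lm; exact: fU. Qed.

(* The group topology for which the [Ulam] are a base of neighborhoods of 0. *)
Definition ilaurent_nbhs f : set_system (ilaurent n A) :=
  [set S | exists lam, [set g | Ulam lam (g - f)] `<=` S].

HB.instance Definition _ := hasNbhs.Build (ilaurent n A) ilaurent_nbhs.

Lemma ilaurent_nbhs_filter f : ProperFilter (nbhs f).
Proof.
apply: Build_ProperFilter_ex.
  by move=> S [lam lS]; exists f; apply: lS; rewrite /= subrr; exact: Ulam0.
split.
- by have [lam] := Lambda_inh n; exists lam.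
- move=> S T [lam lS] [mu mT]; have [nu nuU] := ZlamU lam mu.
  exists nu => g gU; split; [apply: lS | apply: mT].
    by apply: (Ulam_sub _ gU) => l lZ; apply: nuU; left.
  by apply: (Ulam_sub _ gU) => l lZ; apply: nuU; right.
- by move=> S T ST [lam lS]; exists lam => g /lS/ST.
Qed.

Lemma ilaurent_nbhs_singleton f S : nbhs f S -> S f.
Proof. by move=> [lam]; apply; rewrite /= subrr; exact: Ulam0. Qed.

Lemma ilaurent_nbhs_nbhs f S : nbhs f S -> nbhs f (nbhs^~ S).
Proof.
move=> [lam lS]; exists lam => g gU; exists lam => h hU; apply: lS => /=.
by rewrite -[h](subrK g) -addrA; exact: UlamD.
Qed.

HB.instance Definition _ := Nbhs_isNbhsTopological.Build (ilaurent n A)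
  ilaurent_nbhs_filter ilaurent_nbhs_singleton ilaurent_nbhs_nbhs.

End IteratedLaurent.

Section FreeModule.
Variables (R : comPzRingType) (X : choiceType).

Definition finsupp_pred : {pred X -> R^o} :=
  fun u => `[< finite_set [set x | u x != 0] >].

(* The free R-module on X: finitely supported functions from X to R. *)
Record freemod : Type := Freemod {
  fcoord :> X -> R^o;
  fcoordP : fcoord \in finsupp_pred }.

HB.instance Definition _ := [isSub for fcoord].
HB.instance Definition _ := [Choice of freemod by <:].

Lemma finsupp_predP (u : X -> R^o) :
  reflect (finite_set [set x | u x != 0]) (u \in finsupp_pred).
Proof. exact: asboolP. Qed.

Lemma finsupp_submod_closed : subsemimod_closed finsupp_pred.
Proof.
split; [split|].
- apply/finsupp_predP; apply: sub_finite_set (finite_set0 X) => x /=.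
  by move=> /eqP[].
- move=> u v /finsupp_predP uf /finsupp_predP vf; apply/finsupp_predP.
  have : finite_set ([set x | u x != 0] `|` [set x | v x != 0]).
    by rewrite finite_setU.
  apply: sub_finite_set => x /= uvx; have [u0|] := eqVneq (u x) 0; [right|by left].
  move: uvx; have -> : (u + v) x = u x + v x by [].
  by rewrite u0 add0r.
- move=> a u /finsupp_predP uf; apply/finsupp_predP.
  apply: sub_finite_set uf => x /=; have -> : (a *: u) x = a * u x by [].
  by apply: contra => /eqP->; rewrite mulr0.
Qed.

HB.instance Definition _ :=
  GRing.isSubmodClosed.Build R (X -> R^o) finsupp_pred finsupp_submod_closed.
HB.instance Definition _ := [SubChoice_isSubLmodule of freemod by <:].

Lemma fgen_subproof (x : X) :
  (fun y => if y == x then 1 else 0) \in finsupp_pred.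
Proof.
apply/finsupp_predP; apply: sub_finite_set (finite_set1 x) => y /=.
by case: (eqVneq y x) => [->//|_]; rewrite eqxx.
Qed.

Definition fgen (x : X) : freemod := Freemod (fgen_subproof x).

Lemma fcoord_finite (u : freemod) : finite_set [set x | u x != 0].
Proof. exact/finsupp_predP/fcoordP. Qed.

Variable W : lmodType R.

(* the R-linear extension of a map defined on generators *)
Definition flift (F : X -> W) (u : freemod) : W :=
  \sum_(x \in [set: X]) (u x : R) *: F x.

Lemma fliftE (F : X -> W) (u : freemod) (s : seq X) : uniq s ->
  (forall x, x \notin s -> u x = 0) -> flift F u = \sum_(x <- s) (u x : R) *: F x.
Proof.
move=> us su; rewrite (fsbig_seq _ _ us); apply/esym/fsbig_widen => //.
by move=> x [_ /= /negP xs]; rewrite su ?scale0r.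
Qed.

Lemma fcoord_seq (u : freemod) :
  exists2 s : seq X, uniq s & forall x, x \notin s -> u x = 0.
Proof.
have /finite_seqP[s sE] := fcoord_finite u.
exists (undup s).
  exact: undup_uniq.
move=> x; rewrite mem_undup => xs; apply/eqP; apply: contraT => ux.
have : [set` s] x by rewrite -sE.
by rewrite /= (negPf xs).
Qed.

Lemma flift_linear F : linear (flift F).
Proof.
move=> a u v; have [s us su] := fcoord_seq u; have [t ut tv] := fcoord_seq v.
have uw : uniq (undup (s ++ t)) by exact: undup_uniq.
rewrite !(@fliftE F _ _ uw) => [|x|x|x]; last 3 first.
- by rewrite mem_undup mem_cat negb_or => /andP[_ /tv].
- by rewrite mem_undup mem_cat negb_or => /andP[/su].
- rewrite mem_undup mem_cat negb_or => /andP[/su ux /tv vx].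
  have -> : (a *: u + v) x = a * u x + v x by [].
  by rewrite ux vx mulr0 addr0.
rewrite scaler_sumr -big_split; apply: eq_bigr => x _.
rewrite [((a *: u + v) x : R)](_ : _ = a * u x + v x :> R)// scalerDl.
by rewrite scalerA.
Qed.

HB.instance Definition _ F := GRing.isLinear.Build R freemod W *:%R (flift F)
  (flift_linear F).

Lemma flift_gen F x : flift F (fgen x) = F x.
Proof.
rewrite (@fliftE F _ [:: x])// ?big_seq1 /= ?eqxx ?scale1r// => y.
by rewrite inE => /negPf->.
Qed.

Lemma freemod_ext (f g : {linear freemod -> W}) :
  (forall x, f (fgen x) = g (fgen x)) -> f =1 g.
Proof.
move=> fg u; have [s us su] := fcoord_seq u.
have -> : u = \sum_(x <- s) (u x : R) *: fgen x.
  apply/val_inj/funext => y /=.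
  have -> : fcoord (\sum_(x <- s) (u x : R) *: fgen x) y =
            \sum_(x <- s) u x * (if y == x then 1 else 0).
    by elim/big_rec2: _ => // x z w _ <-.
  have [ys|/[dup] ys /su->] := boolP (y \in s); last first.
    rewrite big_seq big1// => x xs; case: eqVneq => [yx|_]; last by rewrite mulr0.
    by rewrite yx xs in ys.
  rewrite (bigD1_seq y)//= eqxx mulr1 big1 ?addr0// => x.
  by rewrite eq_sym => /negPf->; rewrite mulr0.
by rewrite !linear_sum; apply: eq_bigr => x _; rewrite !linearZ fg.
Qed.

End FreeModule.

Section QuotientModule.
Variables (R : comPzRingType) (V : lmodType R) (S : set V).

(* the R-submodule generated by S *)
Inductive span : V -> Prop :=
| span0 : span 0
| span_lin a u v : S u -> span v -> span (a *: u + v).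

Definition span_pred : {pred V} := fun v => `[< span v >].

Lemma span_predP v : reflect (span v) (v \in span_pred).
Proof. exact: asboolP. Qed.

Lemma span_submod_closed : subsemimod_closed span_pred.
Proof.
split; [split|].
- exact/span_predP/span0.
- move=> u v /span_predP su /span_predP sv; apply/span_predP.
  by elim: su => [|a w z Sw _ IH]; rewrite ?add0r// -addrA; exact: span_lin.
- move=> a u /span_predP su; apply/span_predP.
  elim: su => [|b w z Sw _ IH]; first by rewrite scaler0; exact: span0.
  by rewrite scalerDr scalerA; exact: span_lin.
Qed.

HB.instance Definition _ :=
  GRing.isSubmodClosed.Build R V span_pred span_submod_closed.

(* the quotient of V by the submodule generated by S *)
Definition lquot : Type := @Quotient.quot V span_pred.
HB.instance Definition _ := GRing.Zmodule.on lquot.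

Definition lpi (v : V) : lquot := \pi_(@Quotient.quot V span_pred)%qT v.

Lemma lpi_zmod : zmod_morphism lpi.
Proof. exact: raddfB. Qed.
HB.instance Definition _ := GRing.isZmodMorphism.Build V lquot lpi lpi_zmod.

Definition lrepr (x : lquot) : V := repr (x : @Quotient.quot V span_pred).

Lemma lreprK : cancel lrepr lpi.
Proof. exact: reprK. Qed.

Lemma lpi_eq u v : lpi u = lpi v <-> span (u - v).
Proof.
split=> [/eqP uv|uv]; first by apply/span_predP; rewrite Quotient.idealrBE.
by apply/eqP; rewrite -[_ == _]Quotient.idealrBE; exact/span_predP.
Qed.

Definition lqscale (a : R) (x : lquot) : lquot := lpi (a *: lrepr x).

Lemma lpi_scale a v : lpi (a *: v) = lqscale a (lpi v).
Proof.
apply/lpi_eq; rewrite -scalerBr; apply/span_predP/rpredZ/span_predP/lpi_eq.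
by rewrite lreprK.
Qed.

Fact lqscaleA a b x : lqscale a (lqscale b x) = lqscale (a * b) x.
Proof. by rewrite -[x]lreprK -!lpi_scale scalerA. Qed.
Fact lqscale1 : left_id 1 lqscale.
Proof. by move=> x; rewrite -[x]lreprK -lpi_scale scale1r. Qed.
Fact lqscaleDr : right_distributive lqscale +%R.
Proof.
move=> a x y; rewrite -[x]lreprK -[y]lreprK -raddfD -!lpi_scale scalerDr.
exact: raddfD.
Qed.
Fact lqscaleDl x : {morph lqscale^~ x : a b / a + b}.
Proof.
by move=> a b; rewrite -[x]lreprK -!lpi_scale scalerDl; exact: raddfD.
Qed.

HB.instance Definition _ := GRing.Zmodule_isLmodule.Build R lquot
  lqscaleA lqscale1 lqscaleDr lqscaleDl.

HB.instance Definition _ := GRing.isScalable.Build R V lquot *:%R lpi lpi_scale.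

Lemma lpi_rel u : S u -> lpi u = 0.
Proof.
move=> Su; rewrite -[RHS](raddf0 lpi); apply/lpi_eq; rewrite subr0.
by rewrite -[u]scale1r -[_ *: u]addr0; exact: span_lin Su span0.
Qed.

Variables (W : lmodType R) (f : {linear V -> W}).

(* the map induced on the quotient by a linear map that vanishes on S *)
Definition llift (fS : forall u, S u -> f u = 0) (x : lquot) : W := f (lrepr x).

Hypothesis fS : forall u, S u -> f u = 0.

Lemma llift_pi u : llift fS (lpi u) = f u.
Proof.
have /lpi_eq : lpi (lrepr (lpi u)) = lpi u by exact: lreprK.
rewrite /llift => sp; apply/eqP; rewrite -subr_eq0 -linearB; apply/eqP.
by elim: sp => [|a v w /fS v0 _ IH]; rewrite ?linear0// linearP v0 scaler0 add0r.
Qed.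

Lemma llift_linear : linear (llift fS).
Proof.
move=> a x y; rewrite -[x]lreprK -[y]lreprK -linearZ -raddfD !llift_pi.
exact: linearP.
Qed.

HB.instance Definition _ := GRing.isLinear.Build R lquot W *:%R (llift fS)
  llift_linear.

End QuotientModule.

Section Kaehler.
Variable L : comPzRingType.

(* The relations of the module of (absolute) Kaehler differentials between the
   generators [fgen f], which stand for the symbols $df$. *)
Inductive kaehler_rel : set (freemod L L) :=
| kaehler_add f g : kaehler_rel (fgen L (f + g) - fgen L f - fgen L g)
| kaehler_mul f g :
    kaehler_rel (fgen L (f * g) - f *: fgen L g - g *: fgen L f).

Definition kaehler : Type := lquot kaehler_rel.
HB.instance Definition _ := GRing.Lmodule.on kaehler.

Definition kd (f : L) : kaehler := lpi kaehler_rel (fgen L f).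

End Kaehler.

Section Exterior.
Variables (R : comPzRingType) (M : lmodType R) (n : nat).
Implicit Types (v : 'I_n -> M) (i j : 'I_n) (x y : M).

Definition fupd v i x : 'I_n -> M := fun j => if j == i then x else v j.

Inductive ext_rel : set (freemod R ('I_n -> M)) :=
| ext_add v i x y : ext_rel
    (fgen R (fupd v i (x + y)) - fgen R (fupd v i x) - fgen R (fupd v i y))
| ext_scale v i a x : ext_rel
    (fgen R (fupd v i (a *: x)) - a *: fgen R (fupd v i x))
| ext_alt v i j : i != j -> v i = v j -> ext_rel (fgen R v).

(* the n-th exterior power of M *)
Definition extpow : Type := lquot ext_rel.
HB.instance Definition _ := GRing.Lmodule.on extpow.

Definition wedge v : extpow := lpi ext_rel (fgen R v).

End Exterior.

Section ExteriorTheory.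
Variables (R : comPzRingType) (M : lmodType R) (n : nat).
Implicit Types (v e : 'I_n -> M) (i j : 'I_n) (x y : M).

Lemma fupd_id v i : fupd v i (v i) = v.
Proof. by apply/funext => j; rewrite /fupd; case: eqP => [->|]. Qed.

Lemma wedgeD v i x y :
  wedge (fupd v i (x + y)) = wedge (fupd v i x) + wedge (fupd v i y).
Proof.
have := lpi_rel (ext_add v i x y); rewrite !linearB => /eqP.
by rewrite -addrA -opprD subr_eq0 => /eqP.
Qed.

Lemma wedgeZ v i a x : wedge (fupd v i (a *: x)) = a *: wedge (fupd v i x).
Proof.
have := lpi_rel (ext_scale v i a x); rewrite linearB linearZ => /eqP.
by rewrite subr_eq0 => /eqP.
Qed.

Lemma wedge_alt v i j : i != j -> v i = v j -> wedge v = 0.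
Proof. by move=> ij vij; exact: lpi_rel (ext_alt ij vij). Qed.

Lemma wedge_sum v i (I : finType) (F : I -> M) :
  wedge (fupd v i (\sum_k F k)) = \sum_k wedge (fupd v i (F k)).
Proof.
elim/big_rec2: _ => [|k y z _ <-]; last exact: wedgeD.
by rewrite -(scale0r (0 : M)) wedgeZ scale0r.
Qed.

Lemma wedge_expand (C : 'M[R]_n) e :
  wedge (fun i => \sum_j C i j *: e j) =
  \sum_(f : {ffun 'I_n -> 'I_n}) (\prod_i C i (f i)) *: wedge (e \o f).
Proof.
pose V (s : seq 'I_n) (g : {ffun 'I_n -> 'I_n}) i :=
  if i \in s then \sum_j C i j *: e j else e (g i).
pose ok (s : seq 'I_n) (g f : {ffun 'I_n -> 'I_n}) :=
  [forall i, (i \notin s) ==> (f i == g i)].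
have VE s g : uniq s -> wedge (V s g) =
    \sum_(f | ok s g f) (\prod_(i <- s) C i (f i)) *: wedge (e \o f).
  elim: s g => [g _|i s IHs g /= /andP[is_ us]].
    rewrite (big_pred1 g) => [|f]; first by rewrite big_nil scale1r.
    apply/forallP/eqP => [fg|-> i]; last by rewrite eqxx implybT.
    by apply/ffunP => i; exact/eqP/fg.
  pose gi j : {ffun 'I_n -> 'I_n} := [ffun k => if k == i then j else g k].
  have -> : V (i :: s) g = fupd (V (i :: s) g) i (\sum_j C i j *: e j).
    by rewrite -[LHS](fupd_id _ i); congr fupd; rewrite /V mem_head.
  rewrite wedge_sum (partition_big (fun f : {ffun _} => f i) xpredT)//=.
  apply: eq_bigr => j _; rewrite wedgeZ.
  have -> : fupd (V (i :: s) g) i (e j) = V s (gi j).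
    apply/funext => k; rewrite /fupd /V inE ffunE.
    by case: eqVneq => //= ->; rewrite (negPf is_).
  rewrite IHs// scaler_sumr; apply: eq_big => [f|f].
    apply/forallP/andP => [fg|[/forallP fg fi] k].
      split; last by have := fg i; rewrite is_ ffunE eqxx.
      apply/forallP => k; rewrite inE negb_or; apply/implyP => /andP[/negPf ki ks].
      by have := fg k; rewrite ks ffunE ki.
    apply/implyP => ks; rewrite ffunE; case: (eqVneq k i) => [->//|ki].
    by have := fg k; rewrite inE negb_or ki ks.
  move=> /forallP/(_ i); rewrite is_ ffunE eqxx => /eqP fi.
  by rewrite big_cons fi scalerA.
have -> : (fun i => \sum_j C i j *: e j) = V (index_enum 'I_n) [ffun i => i].
  by apply/funext => i; rewrite /V mem_index_enum.
rewrite VE ?index_enum_uniq//; apply: eq_bigl => f.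
by apply/forallP => i; rewrite mem_index_enum.
Qed.

Lemma wedge_tperm v i j : i != j -> wedge (v \o tperm i j) = - wedge v.
Proof.
move=> ij; apply/eqP; rewrite -addr_eq0; apply/eqP.
pose u x y := fupd (fupd v i x) j y.
have uD x y z t : wedge (u (x + y) (z + t)) =
    wedge (u x z) + wedge (u x t) + (wedge (u y z) + wedge (u y t)).
  have C a b : fupd (fupd v i a) j b = fupd (fupd v j b) i a.
    apply/funext => k; rewrite /fupd.
    by case: (eqVneq k j) => // ->; rewrite eq_sym (negPf ij).
  by rewrite /u wedgeD !C !wedgeD -!C addrACA.
have u0 x : wedge (u x x) = 0.
  by apply: (wedge_alt ij); rewrite /u /fupd eqxx (negPf ij) eqxx.
have := uD (v i) (v j) (v i) (v j); rewrite !u0 add0r addr0 => /esym.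
rewrite addrC; congr (_ + _ = _); congr wedge; apply/funext => k;
  rewrite /u /fupd /=.
  case: tpermP => [->|->|/eqP/negPf-> /eqP/negPf->//]; last by rewrite eqxx.
  by rewrite (negPf ij) eqxx.
by case: eqVneq => [->//|_]; case: eqVneq => [->|].
Qed.

Lemma wedge_perm v (s : 'S_n) : wedge (v \o s) = (-1) ^+ s *: wedge v.
Proof.
have [ts -> dts] := prod_tpermP s; elim: ts dts v => [_ v|t ts IH /= /andP[dt dts] v].
  rewrite big_nil odd_perm1 scale1r; congr wedge.
  by apply/funext => i /=; rewrite perm1.
rewrite big_cons odd_permM odd_tperm dt signr_addb expr1 mulN1r scaleNr -IH//.
rewrite -(wedge_tperm _ dt); congr wedge.
by apply/funext => i; rewrite /= permM.
Qed.

Lemma wedge_det (C : 'M[R]_n) e :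
  wedge (fun i => \sum_j C i j *: e j) = \det C *: wedge e.
Proof.
rewrite wedge_expand (bigID (fun f : {ffun 'I_n -> 'I_n} => injectiveb f)) /=.
rewrite [X in _ + X]big1 ?addr0 => [|f /injectivePn[i [j ij fij]]]; last first.
  by rewrite (@wedge_alt _ i j)// ?scaler0//= fij.
rewrite (reindex (@pval _)) /=; last first.
  pose in_Sn := insubd (1%g : 'S_n).
  by exists in_Sn => /= f Uf; first apply: val_inj; apply: insubdK.
rewrite scaler_suml; apply: eq_big => /= [s|s _]; first by rewrite (valP s).
have -> : e \o pval s = e \o s by apply/funext => i; rewrite /= pvalE.
rewrite wedge_perm scalerA mulrC; congr (_ * _ *: _).
by apply: eq_bigr => i _; rewrite pvalE.
Qed.

End ExteriorTheory.

Section Forms.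
Variables (n : nat) (A : comPzRingType).
Inductive tform_rel : set (kaehler (ilaurent n A)) :=
| tform_cont (f : ilaurent n A) :
    tform_rel (kd f - \sum_(i < n) ideriv i f *: kd (ivar A i)).

(* $\widetilde\Omega^1_{\mathcal L^n(A)}$ *)
Definition tform1 : Type := lquot tform_rel.
HB.instance Definition _ := GRing.Lmodule.on tform1.

Definition td (f : ilaurent n A) : tform1 := lpi tform_rel (kd f).

(* $\widetilde\Omega^n_{\mathcal L^n(A)}$ *)
Definition tform : Type := extpow tform1 n.
HB.instance Definition _ := GRing.Lmodule.on tform.

(* $dt_1\wedge\ldots\wedge dt_n$ *)
Definition tvol : tform := wedge (fun i => td (ivar A i)).

(* [tcoord]: coordinates of a 1-form with respect to $dt_1,\ldots,dt_n$ *)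
Definition fgrad : freemod (ilaurent n A) (ilaurent n A) -> 'rV[ilaurent n A]_n :=
  flift (fun f => \row_i ideriv i f).
HB.instance Definition _ := GRing.Linear.on fgrad.

Fact fgrad_rel u : kaehler_rel u -> fgrad u = 0.
Proof.
case=> f g; rewrite 2!raddfB /=; apply/rowP => i.
  by rewrite /fgrad !flift_gen !mxE raddfD [_ + _ - _]addrAC addrK subrr.
rewrite !linearZ /= /fgrad !flift_gen !mxE ideriv_leibniz !mulrN.
by rewrite [_ + _ - _]addrAC addrK subrr.
Qed.

Definition kgrad : kaehler (ilaurent n A) -> 'rV[ilaurent n A]_n :=
  llift fgrad_rel.
HB.instance Definition _ := GRing.Linear.on kgrad.

Fact kgrad_rel u : tform_rel u -> kgrad u = 0.
Proof.
have E f : kgrad (kd f) = \row_i ideriv i f.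
  by rewrite /kgrad /kd llift_pi; exact: flift_gen.
case=> f; rewrite raddfB /=.
have -> : kgrad (\sum_(i < n) ideriv i f *: kd (ivar A i)) =
    \sum_(i < n) ideriv i f *: \row_j (j == i)%:R.
  rewrite raddf_sum; apply: eq_bigr => i _; rewrite [LHS]linearZ /= E.
  by congr (_ *: _); apply/rowP => j; rewrite !mxE ideriv_var.
rewrite E; apply/rowP => j; rewrite !mxE summxE (bigD1 j)//= big1 => [|i ij].
  by rewrite !mxE eqxx mulr1 addr0 subrr.
by rewrite !mxE eq_sym (negPf ij) mulr0.
Qed.

Definition tcoord : tform1 -> 'rV[ilaurent n A]_n := llift kgrad_rel.
HB.instance Definition _ := GRing.Linear.on tcoord.

Lemma tcoord_td f : tcoord (td f) = \row_i ideriv i f.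
Proof. by rewrite /tcoord /td llift_pi /= /kgrad /kd llift_pi; exact: flift_gen. Qed.

Lemma tdE f : td f = \sum_i ideriv i f *: td (ivar A i).
Proof.
have := lpi_rel (tform_cont f); rewrite linearB linear_sum /= => /eqP.
rewrite subr_eq0 => /eqP E; rewrite [LHS]E; apply: eq_bigr => i _.
exact: linearZ.
Qed.

(* $dt_1,\ldots,dt_n$ generate the module of 1-forms *)
Lemma tcoordK x : \sum_i tcoord x 0 i *: td (ivar A i) = x.
Proof.
pose h := fun x : tform1 => \sum_i tcoord x 0 i *: td (ivar A i).
have h_lin : linear h.
  move=> a y z; rewrite /h scaler_sumr -big_split; apply: eq_bigr => i _ /=.
  by rewrite linearP !mxE scalerDl scalerA.
pose hL := GRing.isLinear.Build (ilaurent n A) tform1 tform1 *:%R h h_lin.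
pose H : {linear tform1 -> tform1} := HB.pack h hL.
pose p : {linear freemod (ilaurent n A) (ilaurent n A) -> tform1} :=
  lpi tform_rel \o lpi (@kaehler_rel (ilaurent n A)).
have E := @freemod_ext _ _ _ (H \o p) p.
have -> : x = p (lrepr (lrepr x)) by rewrite /= lreprK lreprK.
apply: E => f; change (h (td f) = td f); rewrite [RHS]tdE.
by apply: eq_bigr => i _; rewrite tcoord_td mxE.
Qed.

(* The module of forms of degree n is free of rank 1 on $dt_1\wedge\ldots\wedge
   dt_n$ ([topcoef_tvol] and [topcoefK] below), and [topcoef] is the coordinate:
   on a wedge product of 1-forms it is the determinant of their coordinates. *)
Definition fdet : freemod (ilaurent n A) ('I_n -> tform1) -> (ilaurent n A)^o :=
  flift (fun v => \det (\matrix_i tcoord (v i)) : (ilaurent n A)^o).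
HB.instance Definition _ := GRing.Linear.on fdet.

Fact fdet_rel u : ext_rel u -> fdet u = 0.
Proof.
pose m v := \matrix_i tcoord (v i) : 'M_n.
have mrow' v i x y : row' i (m (fupd v i x)) = row' i (m (fupd v i y)).
  by apply/matrixP => j k; rewrite !mxE /fupd eq_sym (negPf (neq_lift _ _)).
have mrow v i x : row i (m (fupd v i x)) = tcoord x.
  by rewrite rowK /fupd eqxx.
case=> [v i x y|v i a x|v i j ij vij].
- rewrite 2!raddfB /= /fdet !flift_gen; apply/eqP.
  rewrite -addrA -opprD subr_eq0; apply/eqP.
  rewrite (@determinant_multilinear _ _ _ (m (fupd v i x)) (m (fupd v i y)) i 1 1).
  + by rewrite !mul1r.
  + by rewrite !mrow raddfD !scale1r.
  + exact: mrow'.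
  + exact: mrow'.
- rewrite raddfB [X in _ - X]linearZ /= /fdet !flift_gen; apply/eqP.
  rewrite subr_eq0; apply/eqP.
  rewrite (@determinant_multilinear _ _ _ (m (fupd v i x)) (m (fupd v i x)) i a 0).
  + by rewrite mul0r addr0.
  + by rewrite !mrow scale0r addr0; exact: linearZ.
  + exact: mrow'.
  + exact: mrow'.
- rewrite /fdet flift_gen; apply: (determinant_alternate ij) => k.
  by rewrite !mxE vij.
Qed.

Definition topcoef : tform -> (ilaurent n A)^o := llift fdet_rel.
HB.instance Definition _ := GRing.Linear.on topcoef.

Lemma topcoef_wedge v : topcoef (wedge v) = \det (\matrix_i tcoord (v i)).
Proof. by rewrite /topcoef /wedge llift_pi; exact: flift_gen. Qed.

Lemma topcoef_tvol f : topcoef (f *: tvol) = f.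
Proof.
rewrite [LHS]linearZ /= /tvol topcoef_wedge.
rewrite (_ : \matrix_i _ = 1%:M) ?det1 ?[LHS]mulr1//.
by apply/matrixP => i j; rewrite !mxE tcoord_td !mxE ideriv_var eq_sym.
Qed.

Lemma topcoefK w : (topcoef w : ilaurent n A) *: tvol = w.
Proof.
pose h := fun w : tform => (topcoef w : ilaurent n A) *: tvol.
have h_lin : linear h.
  by move=> a y z; rewrite /h linearP scalerDl scalerA.
pose hL := GRing.isLinear.Build (ilaurent n A) tform tform *:%R h h_lin.
pose H : {linear tform -> tform} := HB.pack h hL.
pose p : {linear freemod (ilaurent n A) ('I_n -> tform1) -> tform} :=
  lpi (@ext_rel _ tform1 n).
have E := @freemod_ext _ _ _ (H \o p) p.
have -> : w = p (lrepr w) by rewrite /= lreprK.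
apply: E => v; change (h (wedge v) = wedge v).
rewrite /h topcoef_wedge /tvol -wedge_det.
by congr wedge; apply/funext => i; rewrite -[RHS]tcoordK; apply: eq_bigr => j _; rewrite mxE.
Qed.

Definition tres (w : tform) : A := icoef (topcoef w) (const_mx (-1)).

Lemma tres_tvol f : tres (f *: tvol) = icoef f (const_mx (-1)).
Proof. by rewrite /tres topcoef_tvol. Qed.

(* the map induced on forms of degree n by an endomorphism phi:
   $f dt_1\wedge\ldots\wedge dt_n\mapsto
    \phi(f) d\phi(t_1)\wedge\ldots\wedge d\phi(t_n)$ *)
Definition tform_map (phi : ilaurent n A -> ilaurent n A) (w : tform) : tform :=
  phi (topcoef w) *: wedge (fun i => td (phi (ivar A i))).

Lemma tform_map_tvol phi f :
  tform_map phi (f *: tvol) = phi f *: wedge (fun i => td (phi (ivar A i))).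
Proof. by rewrite /tform_map topcoef_tvol. Qed.

End Forms.

(* Main.v *)
From HB Require Import structures.
From mathcomp Require Import all_boot all_order all_algebra.
From mathcomp Require Import perm ring zify.
From mathcomp Require Import all_classical.
From mathcomp Require Import topology_structure.
From mathcomp Require finmap.finmap multinomials.monalg.
Require Import Defs.

Set Implicit Arguments.
Unset Strict Implicit.
Unset Printing Implicit Defensive.
Import Order.TTheory GRing.Theory Num.Theory.

Local Open Scope classical_set_scope.
Local Open Scope ring_scope.

(* Put f_i = phi(t_i).  The map x |-> res(phi(x) df_1 /\ ... /\ df_n) is additive
   and continuous, hence determined by its values on monomials.  For a monomial
   other than (t_1...t_n)^-1 some factor is q^k dq with k >= 0 and q = f_i or
   q = 1/f_i; multiplying q by powers of the f_j, j <> i, makes all the exponents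
   nonnegative.  Then no inverse is left, so the form lifts to a torsion-free
   ring, where a multiple of it is exact and its residue vanishes.  So
   res(phi(w)) = c res(w) with c = res(dlog f_1 /\ ... /\ dlog f_n).
   To see that c = 1, embed A into a product of quotients in which all nonzero
   ideals have a common nonzero element: these are connected, and phi descends
   to them by density.  Over a connected ring a unit of the iterated Laurent
   series is a monomial times constants and factors 1 + q with q^j -> 0, and these
   do not contribute to c; hence c = det N, where N is the matrix of the leading
   exponents of the f_i.  Since g^j -> 0 exactly when the leading exponent of g is
   lexicographically positive, N preserves the lexicographic order of Z^n and is
   invertible; it is then triangular with determinant 1. *)

(** * Nilpotent elements and rings without nontrivial idempotents *)

Section Nilpotent.
Variable R : comPzRingType.
Implicit Types x y : R.

Definition nilpotent x := exists N, x ^+ N = 0.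

Definition connected_ring := 
  forall e : R, e * e = e -> e = 0 \/ e = 1.

Lemma nilp0 : nilpotent 0.
Proof. by exists 1%N; rewrite expr1. Qed.

Lemma nilpMl x y : nilpotent y -> nilpotent (x * y).
Proof. by move=> [N y0]; exists N; rewrite exprMn y0 mulr0. Qed.

Lemma nilpMr x y : nilpotent x -> nilpotent (x * y).
Proof. by rewrite mulrC; exact: nilpMl. Qed.

Lemma nilpN x : nilpotent x -> nilpotent (- x).
Proof. by rewrite -mulN1r; exact: nilpMl. Qed.

Lemma expr_eq0_le x (M N : nat) : x ^+ M = 0 -> (M <= N)%N -> x ^+ N = 0.
Proof. by move=> x0 MN; rewrite -(subnKC MN) exprD x0 mul0r. Qed.

Lemma nilpD x y : nilpotent x -> nilpotent y -> nilpotent (x + y).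
Proof.
move=> [M x0] [N y0]; exists (M + N)%N; rewrite exprDn big1// => i _.
have [iN|iN] := leqP N i; first by rewrite (expr_eq0_le y0 iN) mulr0 mul0rn.
by rewrite (@expr_eq0_le x M)// ?mul0r ?mul0rn//; lia.
Qed.

Lemma nilpB x y : nilpotent x -> nilpotent y -> nilpotent (x - y).
Proof. by move=> nx ny; exact/nilpD/nilpN. Qed.

Lemma nilp_sum (I : eqType) (s : seq I) (P : pred I) (F : I -> R) :
  (forall i, i \in s -> P i -> nilpotent (F i)) -> 
  nilpotent (\sum_(i <- s | P i) F i).
Proof.
move=> Fn; rewrite big_seq_cond.
apply: (@big_ind _ nilpotent); [exact: nilp0 | exact: nilpD |].
by move=> i /andP[]; exact: Fn.
Qed.

Lemma nilpX x k : nilpotent (x ^+ k) -> nilpotent x.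
Proof. by move=> [N]; rewrite -exprM; exists (k * N)%N. Qed.

Lemma nilp_unit x : nilpotent x -> exists y, (1 - x) * y = 1.
Proof.
move=> [N x0]; exists (\sum_(i < N) x ^+ i).
by apply/eqP; rewrite -eqr_opp -mulNr opprB -subrX1 x0 sub0r.
Qed.

(* If [x] is idempotent modulo nilpotents, then [(1 - x ^+ N) ^+ N] is an
   idempotent congruent to [1 - x] modulo nilpotents. *)
Lemma connected_nilp x : connected_ring ->
  nilpotent (x * (1 - x)) -> nilpotent x \/ nilpotent (1 - x).
Proof.
move=> conn [N x0]; pose y := x ^+ N; pose e := (1 - y) ^+ N.
have [u eu] : exists u, e = (1 - x) ^+ N * u.
  exists ((\sum_(i < N) x ^+ i) ^+ N); rewrite -exprMn; congr (_ ^+ _).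
  by rewrite -[LHS]opprB -[1 - x]opprB mulNr -subrX1.
have [v ev] : exists v, 1 - e = y * v.
  exists (\sum_(i < N) (1 - y) ^+ i).
  by rewrite -opprB subrX1 -mulNr opprB subKr.
have ee : e * (1 - e) = 0.
  by rewrite ev eu mulrACA /y [(1 - x) ^+ N * _]mulrC -exprMn x0 mul0r.
have /conn[e0|e1] : e * e = e.
  by apply/eqP; rewrite eq_sym -subr_eq0 -{1}[e]mulr1 -mulrBr ee.
- right; exists N; have yv1 : y * v = 1 by rewrite -ev e0 subr0.
  by rewrite -[LHS]mulr1 -[X in _ * X]yv1 mulrA [_ * y]mulrC -exprMn x0 mul0r.
- left; exists N; by rewrite -[LHS]mulr1 -[X in _ * X]e1 eu mulrA -exprMn x0 mul0r.
Qed.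

End Nilpotent.

(** * Lower bounds on exponents and nilpotent coefficients of Laurent series *)

Section LaurentNilpotent.
Variable B : comPzRingType.
Implicit Types (f g h x y : laurent B) (i j k a b : int).

Lemma lcoef_sum (I : Type) (s : seq I) (P : pred I) (F : I -> laurent B) k :
  (\sum_(i <- s | P i) F i) k = \sum_(i <- s | P i) F i k.
Proof. by elim/big_rec2: _ => // i y z _ <-; rewrite lcoefD. Qed.

Lemma lcoefMn f m k : (f *+ m) k = f k *+ m.
Proof. by elim: m => // m IHm; rewrite !mulrS lcoefD IHm. Qed.

Definition low f a := forall i, i < a -> f i = 0.

Lemma low_le f a b : a <= b -> low f b -> low f a.
Proof. by move=> ab fb i ia; apply: fb; exact: lt_le_trans ab. Qed.

Lemma low0 a : low 0 a.
Proof. by []. Qed.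

Lemma low1 : low 1 0.
Proof. by move=> i i0; rewrite lcoef1; case: eqP => // i0'; lia. Qed.

Lemma lowD f g a : low f a -> low g a -> low (f + g) a.
Proof. by move=> fa ga i ia; rewrite lcoefD fa// ga// addr0. Qed.

Lemma lowMn f a m : low f a -> low (f *+ m) a.
Proof. by move=> fa i ia; rewrite lcoefMn fa// mul0rn. Qed.

Lemma low_sum (I : Type) (s : seq I) (P : pred I) (F : I -> laurent B) a :
  (forall t, P t -> low (F t) a) -> low (\sum_(i <- s | P i) F i) a.
Proof. by move=> Fa; apply: (big_ind (low^~ a)) => // x y; exact: lowD. Qed.

Lemma lcoefM_bounded f g a b k : low f a -> low g b ->
  exists2 s : seq int, uniq s & (f * g) k = \sum_(i <- s) f i * g (k - i) /\
  forall i, i \notin s -> f i * g (k - i) = 0.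
Proof.
move=> fa gb; have [s us sP] := lcoefM_range a b k; exists s => //.
have s0 i : i \notin s -> f i * g (k - i) = 0.
  by move=> /sP[/fa|/gb] ->; rewrite ?mul0r ?mulr0.
by split=> //; exact: lcoefME.
Qed.

Lemma lowM f g a b : low f a -> low g b -> low (f * g) (a + b).
Proof.
move=> fa gb k kab; rewrite (@lcoefME _ f g k [::]) ?big_nil// => i _.
have [/fa->|ai] := ltP i a; first by rewrite mul0r.
by rewrite gb ?mulr0//; lia.
Qed.

Lemma lowX f a (m : nat) : low f a -> low (f ^+ m) (a * m%:Z).
Proof.
move=> fa; elim: m => [|m IHm]; first by rewrite mulr0 expr0; exact: low1.
by rewrite exprS (_ : a * m.+1%:Z = a + a * m%:Z); [exact: lowM|lia].
Qed.

Lemma laurent_low f : exists a, low f a.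
Proof. exact: laurent_bound. Qed.

Lemma lconstM c f k : (lconst c * f) k = c * f k.
Proof. by rewrite lmonoM subr0. Qed.

Lemma lconstX (c : B) m : lconst c ^+ m = lconst (c ^+ m).
Proof. by rewrite rmorphXn. Qed.

(** A Gauss lemma modulo nilpotents, by induction on the distance of [i + j] from the sum of the
    lower bounds of [f] and [g]. Multiply the coefficient of degree [i + j] of [f * g] by
    [f i * g j]: a term with [k < i] contains [f k * g j], a term with [k > i] contains
    [f i * g (i + j - k)], both of smaller degree. So the square of [f i * g j] is nilpotent. *)
Lemma gauss_nilp f g S : (forall s, s < S -> nilpotent ((f * g) s)) ->
  forall i j, i + j < S -> nilpotent (f i * g j).
Proof.
move=> fgS; have [a fa] := laurent_low f; have [b gb] := laurent_low g.
suff H (m : nat) i j : i + j < S -> i + j < a + b + m%:Z ->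
    nilpotent (f i * g j).
  by move=> i j ijS; apply: (H (absz (i + j - a - b + 1))) => //; lia.
elim: m i j => [|m IHm] i j ijS ijm.
  have [/fa->|ai] := ltP i a; first by rewrite mul0r; exact: nilp0.
  by rewrite (gb j) ?mulr0; [exact: nilp0|lia].
have [l ul [fgE l0]] := lcoefM_bounded (i + j) fa gb.
have jE : j = i + j - i by lia.
have [il|/l0] := boolP (i \in l); last by rewrite -jE => ->; exact: nilp0.
have := fgS _ ijS; rewrite fgE (bigD1_seq i)//= -jE => nfg.
apply: (@nilpX _ _ 2); rewrite expr2.
move: nfg; set S' := \sum_(_ <- _ | _) _ => nfg.
rewrite -{2}[f i * g j](addrK S') mulrBr; apply: nilpB; first exact: nilpMl.
rewrite /S' mulr_sumr; apply: nilp_sum => k _ ki.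
have [k_lt|k_ge] := ltP k i.
  rewrite [_ * _](_ : _ = f k * g j * (f i * g (i + j - k))); last by ring.
  by apply: nilpMr; apply: IHm; lia.
rewrite [_ * _](_ : _ = f i * g (i + j - k) * (f k * g j)); last by ring.
by apply: nilpMr; apply: IHm; lia.
Qed.

End LaurentNilpotent.

(** * Idempotents and units of Laurent series *)

Section LaurentUnits.
Variable B : comPzRingType.
Implicit Types (f g h x y : laurent B) (i j k a b : int).

Lemma low_lmono (c : B) i : low (lmono c i) i.
Proof. by move=> j ji /=; case: eqP => // jE; lia. Qed.

Lemma lmonoMM (c d : B) i j : lmono c i * lmono d j = lmono (c * d) (i + j).
Proof.
apply: laurentP => k; rewrite lmonoM /=.
have -> : (k - i == j) = (k == i + j) by apply/eqP/eqP; lia.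
by case: ifP => _; rewrite ?mulr0.
Qed.

Lemma lmonoX (c : B) i m : lmono c i ^+ m = lmono (c ^+ m) (i * m%:Z).
Proof.
elim: m => [|m IHm]; first by rewrite !expr0 mulr0.
by rewrite exprS IHm lmonoMM exprS; congr lmono; lia.
Qed.

Lemma lmono0 i : lmono (0 : B) i = 0.
Proof. by apply: laurentP => k /=; case: ifP. Qed.

Lemma nilp_lmono (c : B) i : nilpotent c -> nilpotent (lmono c i).
Proof. by move=> [N c0]; exists N; rewrite lmonoX c0 lmono0. Qed.

(** The induction on [N] only assumes that the coefficients of [x ^+ N] are nilpotent. By
    [gauss_nilp], if this holds for [y ^+ N.+1] with [N > 0], it holds for the [N]-th power of
    [lconst (y i) * y], whose [i]-th coefficient is the square of [y i]. *)
Lemma nilp_laurent_coef x i : nilpotent x -> nilpotent (x i).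
Proof.
move=> [N xN].
suff H : forall N x, (forall j, nilpotent ((x ^+ N) j)) ->
    forall i, nilpotent (x i).
  by apply: (H N) => j; rewrite xN; exact: nilp0.
elim=> [|{}N IHN] {xN i}y yN i.
  have n1 : nilpotent (1 : B) by have := yN 0; rewrite expr0 lcoef1.
  by rewrite -[y i]mulr1; exact: nilpMl.
have [N0E|N0] := posnP N; first by have := yN i; rewrite N0E expr1.
have yiN j k : nilpotent (y j * (y ^+ N) k).
  apply: (@gauss_nilp _ _ _ (j + k + 1)) => [s _|]; last by lia.
  by rewrite -exprS.
apply: (@nilpX _ _ 2); rewrite expr2 -lconstM; apply: IHN => j.
rewrite exprMn lconstX lconstM -(prednK N0) exprS -mulrA mulrCA.
by apply: nilpMl; rewrite (prednK N0).
Qed.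

(** Split [g] as [y + x], where [x] collects the finitely many terms with nonpositive exponents and
    is therefore nilpotent. In the binomial expansion of [g ^+ j] the power of [x] stays bounded, so
    that of [y] grows with [j]. *)
Lemma low_expr g : (forall i, i <= 0 -> nilpotent (g i)) ->
  exists C : int, forall j : nat, low (g ^+ j) (j%:Z - C).
Proof.
move=> g_nil; have [a ga] := laurent_low g.
pose x := \sum_(i < absz (a - 1)) lmono (g (- i%:Z)) (- i%:Z).
have [M xM] : nilpotent x.
  by apply: nilp_sum => i _ _; apply/nilp_lmono/g_nil; lia.
have xlow : low x (- `|a - 1|).
  by apply: low_sum => i _; apply: (low_le _ (@low_lmono _ _)); have := ltn_ord i; lia.
have xE i : i <= 0 -> x i = g i.
  move=> i0; rewrite lcoef_sum /=; have [iN|iN] := ltnP (absz i) (absz (a - 1)).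
    rewrite (bigD1 (Ordinal iN))//= big1 => [|k]; last first.
      rewrite -val_eqE /= => ki; case: eqP => // ik.
      by move: ki; rewrite ik; lia.
    have -> : - (`|i|%N : int) = i by lia.
    by rewrite eqxx addr0.
  rewrite big1 => [|k _]; first by rewrite ga//; lia.
  by case: eqP => // ik; have := ltn_ord k; lia.
pose y := g - x; have ylow : low y 1.
  by move=> i i1; rewrite lcoefD lcoefN xE ?subrr//; lia.
have gE : g = y + x by rewrite /y subrK.
(* Fewer than [M] factors [x] occur, and each factor [x] in place of a [y] lowers the bound by
   [|a - 1| + 1]. *)
exists ((`|a - 1| + 1) * M%:Z) => j; rewrite gE exprDn; apply: low_sum => b _.
have [bM|bM] := leqP M b.
  by rewrite (expr_eq0_le xM bM) mulr0 mul0rn; exact: low0.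
apply: lowMn; apply: (low_le _ (lowM (lowX ylow) (lowX xlow))).
have := ltn_ord b; nia.
Qed.

Lemma low_all_eq0 f : (forall a, low f a) -> f = 0.
Proof. by move=> f0; apply: laurentP => k; rewrite (f0 (k + 1))//; lia. Qed.

(** By [gauss_nilp] applied to [e * (1 - e) = 0], the coefficients of [e] off degree 0 are nilpotent
    and [e 0] is idempotent modulo nilpotents. Hence [e] or [1 - e] has nilpotent coefficients in
    all degrees up to 0; being equal to its own powers, it vanishes by [low_expr]. *)
Lemma connected_laurent : connected_ring B -> connected_ring (laurent B).
Proof.
move=> conn e ee.
have idem0 f : f * f = f -> (forall i, i <= 0 -> nilpotent (f i)) -> f = 0.
  move=> ff /low_expr[C fC]; apply: low_all_eq0 => a.
  have fX (j : nat) : f ^+ j.+1 = f.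
    by elim: j => [|j IHj]; rewrite ?expr1// exprS IHj.
  rewrite -(fX (absz (a + C))); apply: (low_le _ (fC _)).
  by lia.
have e1e : e * (1 - e) = 0 by rewrite mulrBr mulr1 ee subrr.
have e_nil i j : nilpotent (e i * (1 - e) j).
  apply: (@gauss_nilp _ _ _ (i + j + 1)) => [s _|]; last by lia.
  by rewrite e1e; exact: nilp0.
have ei i : i != 0 -> nilpotent (e i).
  move=> i0; apply: (@nilpX _ _ 2); rewrite expr2 -[X in nilpotent X]opprK.
  rewrite -mulrN; apply: nilpN; have := e_nil i i.
  by rewrite lcoefD lcoefN lcoef1 (negPf i0) add0r.
have [e0|e0] : nilpotent (e 0) \/ nilpotent (1 - e 0).
- apply: connected_nilp => //; exact: (e_nil 0 0).
- left; apply: idem0 => // i _; have [->//|i0] := eqVneq i 0; exact: ei.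
- right; apply/eqP; rewrite eq_sym -subr_eq0; apply/eqP; apply: idem0.
    by rewrite mulrBl e1e subr0 mul1r.
  move=> i _; have [->//|i0] := eqVneq i 0.
  by rewrite lcoefD lcoefN lcoef1 (negPf i0) add0r; apply/nilpN/ei.
Qed.

(** The products [g i * h (- i)] sum to 1 and are orthogonal modulo nilpotents, hence idempotent
    modulo nilpotents. By connectedness one of them, at [m], is 1 modulo nilpotents; [h (- m)] then
    makes all [g i] with [i < m] nilpotent. *)
Lemma laurent_unit_lead g h : connected_ring B -> 1 <> 0 :> B -> g * h = 1 ->
  exists m (u : B), g m * u = 1 /\ forall i, i < m -> nilpotent (g i).
Proof.
move=> conn B1 gh; have [a ga] := laurent_low g; have [b hb] := laurent_low h.
have gh_nil i j : i + j < 0 -> nilpotent (g i * h j).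
  apply: gauss_nilp => s s0; rewrite gh lcoef1; case: eqP => [s0'|_].
    by move: s0; rewrite s0' ltxx.
  exact: nilp0.
have [l ul [ghE l0]] := lcoefM_bounded 0 ga hb.
pose e i := g i * h (0 - i).
have sum1 : \sum_(i <- l) e i = 1 by rewrite -ghE gh lcoef1 eqxx.
have e_orth i j : i != j -> nilpotent (e i * e j).
  move=> ij; have [lt_ij|ge_ij] := ltP i j.
    rewrite /e [_ * _](_ : _ = g i * h (0 - j) * (g j * h (0 - i))); last by ring.
    by apply/nilpMr/gh_nil; lia.
  rewrite /e [_ * _](_ : _ = g j * h (0 - i) * (g i * h (0 - j))); last by ring.
  by apply/nilpMr/gh_nil; lia.
have e_idem i : i \in l -> nilpotent (e i) \/ nilpotent (1 - e i).
  move=> il; apply: connected_nilp => //; rewrite -sum1 (bigD1_seq i)//=.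
  rewrite addrAC subrr add0r mulr_sumr; apply: nilp_sum => j _ ji.
  by apply: e_orth; rewrite eq_sym.
have [[m ml em]|none] := pselect (exists2 m, m \in l & nilpotent (1 - e m)).
  have [u] := nilp_unit em; rewrite subKr => emu.
  exists m, (h (0 - m) * u); split; first by rewrite mulrA.
  move=> i im; have -> : g i = g i * h (0 - m) * (g m * u).
    by rewrite -[LHS]mulr1 -emu /e; ring.
  by apply/nilpMr/gh_nil; lia.
have [N] : nilpotent (1 : B).
  rewrite -sum1; apply: nilp_sum => i il _.
  by have [//|ei] := e_idem i il; case: none; exists i.
by rewrite expr1n => /B1.
Qed.

Lemma laurent_leadM f g m k : (forall i, i < m -> nilpotent (f i)) ->
  (forall i, i < k -> nilpotent (g i)) ->
  (forall i, i < m + k -> nilpotent ((f * g) i)) /\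
  nilpotent ((f * g) (m + k) - f m * g k).
Proof.
move=> fm gk; have [a fa] := laurent_low f; have [b gb] := laurent_low g.
split=> [s sS|].
  have [l ul [-> _]] := lcoefM_bounded s fa gb.
  apply: nilp_sum => i _ _; have [im|mi] := ltP i m; first exact/nilpMr/fm.
  by apply/nilpMl/gk; lia.
have [l ul [-> l0]] := lcoefM_bounded (m + k) fa gb.
have kE : m + k - m = k by lia.
have tail : nilpotent (\sum_(i <- l | i != m) f i * g (m + k - i)).
  apply: nilp_sum => i _ im; have [lt_im|mi] := ltP i m; first exact/nilpMr/fm.
  by apply/nilpMl/gk; lia.
have [ml|ml] := boolP (m \in l).
  by rewrite (bigD1_seq m)//= kE addrAC subrr add0r.
have := l0 _ ml; rewrite kE => ->; rewrite subr0.
rewrite big_seq_cond [X in nilpotent X](eq_bigl (fun i => (i \in l) && (i != m))).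
  by rewrite -big_seq_cond.
by move=> i; rewrite andbT andb_idr// => il; apply: contra ml => /eqP<-.
Qed.

End LaurentUnits.

(** * Multi-indices, monomials and coefficients of iterated Laurent series *)

Definition row_rcons n (l : 'rV[int]_n) (k : int) : 'rV[int]_n.+1 :=
  \row_i (if unlift ord_max i is Some j then l 0 j else k).

Lemma row_rcons_max n (l : 'rV[int]_n) k : row_rcons l k 0 ord_max = k.
Proof. by rewrite mxE unlift_none. Qed.

Lemma col'_row_rcons n (l : 'rV[int]_n) k : col' ord_max (row_rcons l k) = l.
Proof. by apply/rowP => j; rewrite !mxE liftK. Qed.

Lemma row_rconsK n (l : 'rV[int]_n.+1) :
  row_rcons (col' ord_max l) (l 0 ord_max) = l.
Proof. by apply/rowP => i; rewrite mxE; case: unliftP => [j ->|->]; rewrite ?mxE. Qed.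

Lemma row_col'P n (l m : 'rV[int]_n.+1) :
  l 0 ord_max = m 0 ord_max -> col' ord_max l = col' ord_max m -> l = m.
Proof. by move=> lm lm'; rewrite -[l]row_rconsK -[m]row_rconsK lm lm'. Qed.

Lemma col'D n (l m : 'rV[int]_n.+1) :
  col' ord_max (l + m) = col' ord_max l + col' ord_max m.
Proof. by apply/rowP => j; rewrite !mxE. Qed.

Lemma col'N n (l : 'rV[int]_n.+1) : col' ord_max (- l) = - col' ord_max l.
Proof. by apply/rowP => j; rewrite !mxE. Qed.

Lemma col'0 n : col' ord_max (0 : 'rV[int]_n.+1) = 0.
Proof. by apply/rowP => j; rewrite !mxE. Qed.

Lemma col'Mn n (l : 'rV[int]_n.+1) j : col' ord_max (l *+ j) = col' ord_max l *+ j.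
Proof. by elim: j => [|j IHj]; rewrite ?col'0// !mulrS col'D IHj. Qed.

Section IteratedMonomials.
Variable A : comPzRingType.
Implicit Types (a b : A).

Fixpoint imono (n : nat) : A -> 'rV[int]_n -> iterL A n :=
  match n return A -> 'rV[int]_n -> iterL A n with
  | 0 => fun a _ => a
  | m.+1 => fun a l => lmono (imono a (col' ord_max l)) (l 0 ord_max)
  end.

Lemma imonoM n a b (l m : 'rV[int]_n) :
  imono a l * imono b m = imono (a * b) (l + m).
Proof.
elim: n l m => [//|n IHn] l m; rewrite [LHS]lmonoMM IHn /= col'D.
by congr lmono; rewrite mxE.
Qed.

Lemma imono_const n a : imono a (0 : 'rV_n) = iconst_ A n a.
Proof. by elim: n => [//|n IHn] /=; rewrite col'0 IHn mxE. Qed.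

Lemma imono1 n : imono 1 (0 : 'rV_n) = 1.
Proof. by rewrite imono_const rmorph1. Qed.

Lemma imonoX n a (l : 'rV[int]_n) j : imono a l ^+ j = imono (a ^+ j) (l *+ j).
Proof.
elim: j => [|j IHj]; first by rewrite !expr0 mulr0n imono1.
by rewrite exprS IHj imonoM exprS mulrS.
Qed.

Lemma imonoE n a (l : 'rV[int]_n) : imono a l = iconst_ A n a * imono 1 l.
Proof. by rewrite -imono_const imonoM mulr1 add0r. Qed.

Lemma icoef_0 n (l : 'rV[int]_n) : icoef_ (0 : iterL A n) l = 0.
Proof. exact: (@icoef0 n A l). Qed.

Lemma icoef_D n (f g : iterL A n) l : icoef_ (f + g) l = icoef_ f l + icoef_ g l.
Proof. exact: (@icoefD n A f g l). Qed.

Lemma icoef_N n (f : iterL A n) l : icoef_ (- f) l = - icoef_ f l.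
Proof. exact: (@icoefN n A f l). Qed.

Lemma icoef_constM n a (f : iterL A n) l :
  icoef_ (iconst_ A n a * f) l = a * icoef_ f l.
Proof. by elim: n f l => [//|n IHn] f l /=; rewrite lconv_mono subr0 IHn. Qed.

Lemma icoef_Mz n (f : iterL A n) (z : int) l : icoef_ (f *~ z) l = icoef_ f l *~ z.
Proof.
have E (j : nat) : icoef_ (f *+ j) l = icoef_ f l *+ j.
  by elim: j => [|j IHj]; rewrite ?icoef_0// !mulrS icoef_D IHj.
by case: z => j; rewrite ?NegzE ?mulrNz ?icoef_N -!pmulrn E.
Qed.

Lemma icoef_imono n a (l m : 'rV[int]_n) :
  icoef_ (imono a l) m = if m == l then a else 0.
Proof.
elim: n l m => [|n IHn] l m /=; first by rewrite [m]thinmx0 [l]thinmx0 eqxx.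
have [lm|lm] := eqVneq (m 0 ord_max) (l 0 ord_max).
  rewrite IHn; congr (if _ then _ else _).
  by apply/eqP/eqP => [|->//]; exact: row_col'P.
by rewrite icoef_0; case: eqP => // ml; rewrite ml eqxx in lm.
Qed.

Lemma ivar_imono n (i : 'I_n) : ivar_ A i = imono 1 (delta_mx 0 i).
Proof.
elim: n i => [[]//|n IHn] i /=; case: unliftP => [j ->|->].
  rewrite IHn mxE /= (negPf (neq_lift _ _)); congr lmono; congr imono.
  by apply/rowP => k; rewrite !mxE (inj_eq lift_inj).
rewrite mxE !eqxx /= -(@imono1 n); congr lmono; congr imono.
by apply/rowP => k; rewrite !mxE /= eq_sym (negPf (neq_lift _ _)).
Qed.

Lemma icoef_deriv n (i : 'I_n) (f : iterL A n) l :
  icoef_ (ideriv_ A i f) l = icoef_ f (l + delta_mx 0 i) *~ (l 0 i + 1).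
Proof.
elim: n i f l => [[]//|n IHn] i f l /=; case: unliftP => [j ->|->] /=.
  rewrite IHn !mxE /= (negPf (neq_lift _ _)) addr0.
  congr (icoef_ _ _ *~ _); apply/rowP => k.
  by rewrite !mxE (inj_eq lift_inj).
rewrite icoef_Mz !mxE !eqxx /=; congr (icoef_ _ _ *~ _); apply/rowP => k.
by rewrite !mxE /= eq_sym (negPf (neq_lift _ _)) addr0.
Qed.

Lemma ideriv_comm n (i j : 'I_n) (f : iterL A n) :
  ideriv_ A i (ideriv_ A j f) = ideriv_ A j (ideriv_ A i f).
Proof.
apply: icoef_inj_ => l; rewrite !icoef_deriv -!addrA [delta_mx _ i + _]addrC.
have [->//|ij] := eqVneq i j.
rewrite -!mulrzA !mxE eqxx /= (negPf ij) [j == i]eq_sym (negPf ij) !addr0.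
by rewrite mulrC.
Qed.

Lemma ideriv_imono n (i : 'I_n) a (l : 'rV[int]_n) :
  ideriv_ A i (imono a l) = imono a (l - delta_mx 0 i) *~ l 0 i.
Proof.
apply: icoef_inj_ => m; rewrite icoef_deriv icoef_Mz !icoef_imono.
rewrite -[m + _ == l]subr_eq0 -[m == _]subr_eq0 opprB addrA addrAC.
case: eqP => [ml|_]; last by rewrite !mul0rz.
congr (_ *~ _); have /rowP/(_ i) := ml; rewrite !mxE !eqxx /=.
by lia.
Qed.

Lemma ideriv_const n (i : 'I_n) a : ideriv_ A i (iconst_ A n a) = 0.
Proof. by rewrite -imono_const ideriv_imono mxE mulr0z. Qed.

End IteratedMonomials.

(** * Neighborhoods of zero and density of finite sums of monomials *)

Section Neighborhoods.
Variable A : comPzRingType.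

Lemma Zlam_point n (l : 'rV[int]_n) : exists lam : Lambda n, Zlam lam l.
Proof.
elim: n l => [|n IHn] l; first by exists tt.
by have [mu muP] := IHn (col' ord_max l); exists (fun=> mu, l 0 ord_max).
Qed.

Lemma Zlam_seq n (I : eqType) (s : seq I) (F : I -> Lambda n) :
  exists nu, forall i, i \in s -> Zlam (F i) `<=` Zlam nu.
Proof.
elim: s => [|i s [nu IHs]]; first by have [nu] := Lambda_inh n; exists nu.
have [mu muP] := ZlamU (F i) nu; exists mu => j; rewrite inE => /orP[/eqP->|js].
  by move=> l lF; apply: muP; left.
by move=> l /(IHs _ js) lnu; apply: muP; right.
Qed.

(* [Ulam lam], see [UlamP]; the form below is the convenient one in inductions
   on [n], where [iterL A n] is a coefficient ring. *)
Definition small n (lam : Lambda n) (f : iterL A n) :=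
  forall l, Zlam lam l -> icoef_ f (- l) = 0.

Implicit Types (n : nat).

Lemma smallS n (lam : Lambda n.+1) (f : iterL A n.+1) :
  small lam f <-> forall k, lam.2 <= k -> small (lam.1 k) ((f : laurent _) (- k)).
Proof.
split=> [fs k lk l lZ|fs l /= [lk lZ]].
  have := fs (row_rcons l k); rewrite /= row_rcons_max col'_row_rcons.
  by rewrite mxE col'N row_rcons_max col'_row_rcons; apply.
by rewrite mxE col'N; exact: fs lZ.
Qed.

Lemma small0 n (lam : Lambda n) : small lam 0.
Proof. by move=> l _; rewrite icoef_0. Qed.

Lemma smallD n (lam : Lambda n) f g : small lam f -> small lam g -> small lam (f + g).
Proof. by move=> fs gs l lZ; rewrite icoef_D fs// gs// addr0. Qed.

Lemma small_sum n (lam : Lambda n) (I : Type) (s : seq I) (P : pred I) F :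
  (forall i, P i -> small lam (F i)) -> small lam (\sum_(i <- s | P i) F i).
Proof. by move=> Fs; apply: big_ind => //; [exact: small0 | exact: smallD]. Qed.

Lemma smallMn n (lam : Lambda n) f j : small lam f -> small lam (f *+ j).
Proof.
by move=> fs; elim: j => [|j IHj]; [exact: small0 | rewrite mulrS; exact: smallD].
Qed.

Lemma small_sub n (lam mu : Lambda n) f : Zlam lam `<=` Zlam mu ->
  small mu f -> small lam f.
Proof. by move=> lm fs l /lm; exact: fs. Qed.

(** Multiplication by [F] is continuous. The coefficient of [f] at [- s] meets that of [F] at [i] in
    degree [- k] with [s = k + i]; since [a <= i] and [lam.2 <= k], finitely many [i] occur for each
    [s], and [Zlam_seq] gives one index for all of them. *)
Lemma small_mul n (F : iterL A n) lam :
  exists mu, forall f, small mu f -> small lam (F * f).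
Proof.
elim: n F lam => [|n IHn] F lam.
  exists tt => f fs l lZ; have /= f0 := fs (- l) I.
  by rewrite /= f0 mulr0.
have [a Fa] := laurent_low F.
have [h hP] := choice (fun ik : int * int => IHn (F ik.1) (lam.1 ik.2)).
pose r s : seq int := [seq a + x%:Z | x <- iota 0 (absz (s - lam.2 - a + 1)).+1].
have [nu nuP] := choice (fun s : int => Zlam_seq (r s) (fun i => h (i, s - i))).
exists (nu, lam.2 + a) => f /smallS /= fs; apply/smallS => k lk.
have [b fb] := laurent_low f.
have [l ul [-> _]] := lcoefM_bounded (- k) Fa fb.
apply: small_sum => i _; have [ia|ai] := ltP i a.
  by rewrite Fa// mul0r; exact: small0.
rewrite -[k](addrK i) -[- (k + i - i)]opprK; apply: (hP (i, k + i - i)) => /=.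
apply: (small_sub (nuP (k + i) i _)).
  by apply/mapP; exists (absz (i - a)); [rewrite mem_iota; lia | lia].
rewrite (_ : - - - (k + i - i) - i = - (k + i)); last by lia.
by apply: fs; lia.
Qed.

(** Only the exponents of the last variable between the lower bound [a] of [f] and [- lam.2] matter;
    the coefficient of each is approximated by induction. *)
Lemma approx n (f : iterL A n) lam : exists s : seq 'rV[int]_n,
  small lam (f - \sum_(l <- s) imono (icoef_ f l) l).
Proof.
elim: n f lam => [|n IHn] f lam.
  exists [:: 0]; rewrite big_seq1 /= subrr; exact: small0.
have [a fa] := laurent_low f.
have [t tP] := choice (fun k : int => IHn (f k) (lam.1 (- k))).
pose ks : seq int := [seq a + x%:Z | x <- iota 0 (absz (- lam.2 - a + 1)).+1].
have uks : uniq ks by rewrite map_inj_uniq ?iota_uniq// => x y; lia.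
exists [seq row_rcons l k | k <- ks, l <- t k]; apply/smallS => k lk.
rewrite big_allpairs_dep lcoefD lcoefN lcoef_sum.
have cE j : (\sum_(l <- t j) imono (icoef_ f (row_rcons l j)) (row_rcons l j)
      : laurent _) (- k) =
    if j == - k then \sum_(l <- t j) imono (icoef_ (f j) l) l else 0.
  rewrite lcoef_sum /=; case: eqVneq => [->|jk].
    by apply: eq_bigr => l _; rewrite row_rcons_max col'_row_rcons eqxx.
  rewrite big1// => l _; rewrite row_rcons_max eq_sym (negPf jk) //.
rewrite (eq_bigr _ (fun j _ => cE j)).
have [kks|kks] := boolP (- k \in ks).
  rewrite (bigD1_seq _ kks uks) /= eqxx [X in _ - (_ + X)]big1 ?addr0; last first.
    by move=> j /negPf->.
  by have := tP (- k); rewrite opprK.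
rewrite big_seq big1 => [|j jks]; last first.
  by case: eqP => // jk; rewrite -jk jks in kks.
rewrite subr0 fa; first exact: small0.
rewrite ltNge; apply: contra kks => ak; apply/mapP.
by exists (absz (- k - a)); [rewrite mem_iota; lia | lia].
Qed.

(** Density in the form used below: [V] carries no topology, and vanishing on one neighborhood of
    zero replaces continuity of [T]. *)
Lemma dense_eq0 n (V : zmodType) (T : {additive iterL A n -> V}) lam f :
  (forall g, small lam g -> T g = 0) ->
  (forall l, T (imono (icoef_ f l) l) = 0) -> T f = 0.
Proof.
move=> Tlam Tmono; have [s sP] := approx f lam.
rewrite -[f](subrK (\sum_(l <- s) imono (icoef_ f l) l)) raddfD Tlam// add0r.
by rewrite raddf_sum big1.
Qed.

Definition pow_to0 n (g : iterL A n) :=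
  forall lam, exists J : nat, forall j, (J <= j)%N -> small lam (g ^+ j).

End Neighborhoods.

(** * Change of the coefficient ring *)

Section CoefficientChange.
Variables (A B : comPzRingType).

Lemma lmap_monoid (C D : comPzRingType) (u : {rmorphism C -> D}) :
  monoid_morphism (lmap u).
Proof.
split=> [|f g]; apply: laurentP => k.
  by rewrite /= !(fun_if u) rmorph1 rmorph0.
have [a fa] := laurent_low f; have [b gb] := laurent_low g.
have [l ul [fgE l0]] := lcoefM_bounded k fa gb.
have -> : lmap u (f * g) k = u ((f * g) k) by [].
rewrite fgE rmorph_sum (@lcoefME _ _ _ _ l)// => [|i /l0].
  by apply: eq_bigr => i _; rewrite rmorphM.
by rewrite /= -rmorphM => ->; rewrite rmorph0.
Qed.

HB.instance Definition _ (C D : comPzRingType) (u : {rmorphism C -> D}) :=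
  GRing.isMonoidMorphism.Build _ _ (lmap u) (lmap_monoid u).

Fixpoint imap (u : {rmorphism A -> B}) n : {rmorphism iterL A n -> iterL B n} :=
  match n return {rmorphism iterL A n -> iterL B n} with
  | 0 => u
  | m.+1 => lmap (imap u m)
  end.

Variable u : {rmorphism A -> B}.

Lemma icoef_imap n (f : iterL A n) l : icoef_ (imap u n f) l = u (icoef_ f l).
Proof. by elim: n f l => [//|n IHn] f l /=; rewrite IHn. Qed.

Lemma imap_deriv n (i : 'I_n) (f : iterL A n) :
  imap u n (ideriv_ A i f) = ideriv_ B i (imap u n f).
Proof.
by apply: icoef_inj_ => l; rewrite icoef_imap !icoef_deriv icoef_imap raddfMz.
Qed.

Lemma imap_mono n a (l : 'rV[int]_n) : imap u n (imono a l) = imono (u a) l.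
Proof.
apply: icoef_inj_ => m; rewrite icoef_imap !icoef_imono.
by case: ifP; rewrite ?rmorph0.
Qed.

Lemma small_imap n (lam : Lambda n) f : small lam f -> small lam (imap u n f).
Proof. by move=> fs l lZ; rewrite icoef_imap fs// rmorph0. Qed.

(** The map [s] need not be additive. As [s 0 = 0], applying it to the coefficients does not enlarge
    the support, so the result is again an iterated Laurent series. *)
Lemma imap_section n (s : B -> A) : s 0 = 0 -> cancel s u ->
  exists t : iterL B n -> iterL A n, cancel t (imap u n) /\
    forall f l, icoef_ (t f) l = s (icoef_ f l).
Proof.
move=> s0 su.
have [t tP] : {t : iterL B n -> iterL A n & forall f, icoef_ (t f) = s \o icoef_ f}.
  apply: (@choice _ _ (fun f g => icoef_ g = s \o icoef_ f)) => f.
  have [lam lamP] := (iterL_support_ (icoef_ f)).1 (ex_intro _ f erefl).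
  apply/iterL_support_; exists lam => l /= sl; apply: lamP => /=.
  by apply: contra sl => /eqP->; rewrite s0.
exists t; split=> [f|f l]; last by rewrite tP.
by apply: icoef_inj_ => l; rewrite icoef_imap tP /= su.
Qed.

End CoefficientChange.

(** * Leading exponents, tame units and convergence of powers to zero *)

Section LeadingExponent.
Variable A : comPzRingType.
Implicit Types (n : nat).

(* [lead g v]: modulo nilpotent coefficients, [v] is the least exponent of [g]
   for the lexicographic order in which the last coordinate dominates, and its
   coefficient is invertible. *)
Fixpoint lead n : iterL A n -> 'rV[int]_n -> Prop :=
  match n return iterL A n -> 'rV[int]_n -> Prop with
  | 0 => fun g _ => exists y, g * y = 1
  | m.+1 => fun g v => (forall i, i < v 0 ord_max -> nilpotent (g i)) /\
                       lead (g (v 0 ord_max)) (col' ord_max v)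
  end.

Lemma lead_nilpD n (g x : iterL A n) v : lead g v -> nilpotent x -> lead (g + x) v.
Proof.
elim: n g x v => [|n IHn] g x v /=.
  move=> [y gy] nx; have [|z zE] := @nilp_unit _ (- (y * x)).
    exact/nilpN/nilpMl.
  exists (y * z); rewrite mulrA -zE; congr (_ * _).
  by rewrite mulrDl gy opprK [x * y]mulrC.
move=> [gv gl] nx; split=> [i iv|]; last exact/IHn/nilp_laurent_coef.
by apply: (nilpD (gv _ iv)); exact: nilp_laurent_coef.
Qed.

Lemma leadM n (f g : iterL A n) v w : lead f v -> lead g w -> lead (f * g) (v + w).
Proof.
elim: n f g v w => [|n IHn] f g v w /=.
  by move=> [y fy] [z gz]; exists (y * z); rewrite mulrACA fy gz mulr1.
move=> [fv fl] [gw gl]; have [lo hi] := laurent_leadM fv gw.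
rewrite mxE col'D; split=> //.
by rewrite -[lconv _ _ _](subrKC (f (v 0 ord_max) * g (w 0 ord_max)));
  apply: lead_nilpD hi; exact: IHn.
Qed.

Lemma lead_imono n (v : 'rV[int]_n) : lead (imono 1 v : iterL A n) v.
Proof.
elim: n v => [|n IHn] v /=; first by exists 1; rewrite mulr1.
rewrite eqxx; split=> // i iv; case: eqP => [ivE|_]; last exact: nilp0.
by rewrite ivE ltxx in iv.
Qed.

Lemma lead1 n : lead (1 : iterL A n) 0.
Proof. by rewrite -imono1; exact: lead_imono. Qed.

Lemma leadX n (g : iterL A n) v j : lead g v -> lead (g ^+ j) (v *+ j).
Proof.
move=> gv; elim: j => [|j IHj]; first by rewrite mulr0n expr0; exact: lead1.
by rewrite mulrS exprS; exact: leadM.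
Qed.

Fixpoint lexpos n : 'rV[int]_n -> Prop :=
  match n return 'rV[int]_n -> Prop with
  | 0 => fun=> False
  | m.+1 => fun v => 0 < v 0 ord_max \/
                     v 0 ord_max = 0 /\ lexpos (col' ord_max v)
  end.

Lemma lexpos_trichotomy n (v : 'rV[int]_n) : [\/ v = 0, lexpos v | lexpos (- v)].
Proof.
elim: n v => [|n IHn] v /=; first by rewrite [v]thinmx0; constructor 1.
rewrite mxE col'N; have [v0|v0|v0] := ltrgtP (v 0 ord_max) 0.
- by constructor 3; left; rewrite oppr_gt0.
- by constructor 2; left.
have [v'|v'|v'] := IHn (col' ord_max v).
- by constructor 1; apply: row_col'P; rewrite ?mxE// v' col'0.
- by constructor 2; right.
- by constructor 3; right; rewrite v0 oppr0.
Qed.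

Lemma low_pow_to0 n (q : iterL A n.+1) (C : int) :
  (forall j : nat, low (q ^+ j : laurent _) (j%:Z - C)) -> pow_to0 q.
Proof.
move=> qC lam; exists (absz (C - lam.2)).+1 => j Jj; apply/smallS => k lk.
by rewrite qC; [exact: small0|lia].
Qed.

Lemma pow_to0_lconst n (q : iterL A n) : pow_to0 q ->
  pow_to0 (lconst q : iterL A n.+1).
Proof.
move=> q0 lam; have [J JP] := q0 (lam.1 0); exists J => j Jj.
apply/smallS => k lk; rewrite lconstX /=.
by case: eqP => [/eqP|_]; [rewrite oppr_eq0 => /eqP-> ; exact: JP | exact: small0].
Qed.

(** If the last coordinate of [v] is positive, [low_expr] applies. If it is zero, write
    [g = lconst c + z] with [c = g 0]: the powers of [c] tend to 0 by induction, and the lower bound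
    of [z ^+ b] grows with [b]. *)
Lemma lead_pow_to0 n (g : iterL A n) v : lead g v -> lexpos v -> pow_to0 g.
Proof.
elim: n g v => [//|n IHn] g v /= [gv gl] [v0|[v0 v'0]].
  have [C gC] : exists C : int, forall j : nat, low (g ^+ j) (j%:Z - C).
    by apply: low_expr => i i0; apply: gv; lia.
  exact: low_pow_to0 gC.
move: gl; rewrite v0 => gl; have g0_to0 := IHn _ _ gl v'0.
pose G : laurent (iterL A n) := g; pose c : iterL A n := G 0.
pose z : laurent (iterL A n) := G - lconst c.
have [C zC] : exists C : int, forall j : nat, low (z ^+ j) (j%:Z - C).
  apply: low_expr => i i0; rewrite lcoefD lcoefN /=; case: eqP => [->|/eqP i0'].
    by rewrite subrr; exact: nilp0.
  by rewrite subr0; apply: gv; rewrite v0; lia.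
have gE : g = lconst c + z by rewrite [RHS]addrC subrK.
move=> lam.
have JP (kb : int * nat) : exists J : nat, forall j, (J <= j)%N ->
    small (lam.1 kb.1) (((z ^+ kb.2) (- kb.1)) * c ^+ j).
  have [mu muP] := small_mul ((z ^+ kb.2) (- kb.1)) (lam.1 kb.1).
  by have [J {}JP] := g0_to0 mu; exists J => j Jj; exact/muP/JP.
have {JP} [J JP] := choice JP.
(* A term with [z ^+ b] reaches degree [- k] only if [b - C <= - k]; with [lam.2 <= k] this leaves
   finitely many pairs [(k, b)], and [Jmax] serves them all. *)
pose bmax := (absz (C - lam.2)).+1; pose kmax := (absz (C - lam.2)).+1.
pose Jmax := \max_(x < kmax) \max_(b < bmax) J (lam.2 + x%:Z, b : nat)%R.
exists (Jmax + bmax)%N => j Jj; apply/smallS => k lk.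
rewrite gE exprDn lcoef_sum; apply: small_sum => b _; rewrite lcoefMn.
apply: smallMn; rewrite lconstX lconstM mulrC.
have [kb|kb] := ltP (- k) (b%:Z - C); first by rewrite zC// mul0r; exact: small0.
apply: (JP (k, b : nat)).
have xk : (absz (k - lam.2) < kmax)%N by rewrite /kmax; lia.
have bb : (b < bmax)%N by rewrite /bmax; lia.
have Jle : (J (k, b : nat) <= Jmax)%N.
  apply: leq_trans (leq_bigmax (Ordinal xk)).
  apply: leq_trans (leq_bigmax (Ordinal bb)) => /=.
  by rewrite (_ : lam.2 + _ = k)//; lia.
by lia.
Qed.

(* When [A] is connected, every unit is a monomial times a tame unit
   ([unit_lead] below). *)
Inductive tame n : iterL A n -> Prop :=
| tame_const a b : a * b = 1 -> tame (iconst_ A n a)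
| tame_1D q u : (1 + q) * u = 1 -> pow_to0 q -> tame (1 + q)
| tameM f g : tame f -> tame g -> tame (f * g).

Lemma tame_lconst n (k : iterL A n) : tame k -> tame (lconst k : iterL A n.+1).
Proof.
elim=> [a b ab|q u qu q0|f g _ ft _ gt].
- exact: (@tame_const n.+1 a b ab).
- rewrite rmorphD rmorph1; apply: (@tame_1D n.+1 _ (lconst u)).
    have := congr1 (@lconst _) qu; rewrite rmorphM rmorphD !rmorph1; exact.
  exact: pow_to0_lconst.
- by rewrite rmorphM; exact: (@tameM n.+1).
Qed.

Hypotheses (A_conn : connected_ring A) (A_nz : 1 <> 0 :> A).

Lemma iterL_connected n : connected_ring (iterL A n).
Proof. by elim: n => [//|n IHn]; exact: connected_laurent. Qed.

Lemma iterL_nz n : 1 <> 0 :> iterL A n.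
Proof.
move=> /(congr1 (fun f => icoef_ f 0)); rewrite -imono1 icoef_imono eqxx.
by rewrite icoef_0.
Qed.

Lemma lead_coef_nilp n (g : iterL A n) v : lead g v -> ~ nilpotent (icoef_ g v).
Proof.
elim: n g v => [|n IHn] g v /=; last by move=> [_]; exact: IHn.
move=> [y gy] [N gN]; apply: A_nz; rewrite -(expr1n _ N) -gy exprMn.
by rewrite [X in X * _]gN mul0r.
Qed.

Lemma lead_nilp n (g : iterL A n) v : lead g v -> ~ nilpotent g.
Proof.
move=> gv [N gN]; have := lead_coef_nilp (leadX N gv).
by rewrite gN icoef_0; apply; exact: nilp0.
Qed.

Lemma lead_inj n (g : iterL A n) v w : lead g v -> lead g w -> v = w.
Proof.
elim: n g v w => [|n IHn] g v w /=; first by rewrite [v]thinmx0 [w]thinmx0.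
move=> [gv lv] [gw lw]; have [vw|wv|vw] := ltrgtP (v 0 ord_max) (w 0 ord_max).
- by have := lead_nilp lv (gw _ vw).
- by have := lead_nilp lw (gv _ wv).
by apply: row_col'P => //; apply: IHn lv _; rewrite vw.
Qed.

(** If the last coordinate of [v] is negative, the points [- (v *+ j)] lie on distinct levels
    [j * d], so each level has to contain one given point, recovered by division by [d]. If it is
    zero, all points lie on level 0 and induction applies. *)
Lemma lexnonpos_multiples n (v : 'rV[int]_n) : ~ lexpos v ->
  exists lam : Lambda n, forall j : nat, Zlam lam (- (v *+ j)).
Proof.
elim: n v => [|n IHn] v /=; first by exists tt.
move=> /not_orP[/negP]; rewrite -leNgt => v_le0 v'.
have [v0|v_lt0] := eqVneq (v 0 ord_max) 0.
  have [|mu muP] := IHn (col' ord_max v); first by move=> v'pos; exact: v'.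
  exists (fun=> mu, 0) => j; rewrite /= !mxE mulmxnE v0 mul0rn oppr0.
  by split=> //; rewrite col'N col'Mn.
pose d := - v 0 ord_max.
have [h hP] := choice (fun k : int =>
  Zlam_point (- (col' ord_max v *+ absz (k %/ d)%Z))).
exists (h, 0) => j; rewrite /= !mxE mulmxnE.
have -> : - (v 0 ord_max *+ j) = j%:Z * d.
  by rewrite -mulNrn -mulr_natl natz.
have d_gt0 : 0 < d by rewrite /d; lia.
split; first by nia.
rewrite col'N col'Mn; have := hP (j%:Z * d).
by rewrite mulzK ?absz_nat// gt_eqF.
Qed.

(** The coefficient of [g ^+ J] at [v *+ J] is not nilpotent, hence nonzero, for every [J], whereas
    the neighborhood from [lexnonpos_multiples] requires it to vanish. *)
Lemma lead_not_pow_to0 n (g : iterL A n) v : lead g v -> ~ lexpos v -> ~ pow_to0 g.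
Proof.
move=> gv /lexnonpos_multiples[lam lamP] /(_ lam)[J /(_ J (leqnn _)) gJ].
have := lead_coef_nilp (leadX J gv); apply.
by rewrite -[v *+ J]opprK gJ//; exact: nilp0.
Qed.

(** Induction on the number of variables: [laurent_unit_lead] finds an invertible coefficient, at
    exponent [m] of the last variable. That coefficient is factored by induction, and dividing [g]
    by its term at [m] leaves a factor [1 + q] with [q ^+ j] tending to 0. *)
Lemma unit_lead n (g h : iterL A n) : g * h = 1 ->
  exists v k, [/\ lead g v, tame k & g = imono 1 v * k].
Proof.
elim: n g h => [|n IHn] g h gh.
  exists 0, g; split; [by exists h | exact: (@tame_const 0 g h) |].
  by rewrite mul1r.
have [m [u [gmu gm_nil]]] :=
  laurent_unit_lead (@iterL_connected n) (@iterL_nz n) gh.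
have [v [k [gmv kt gmE]]] := IHn _ _ gmu.
pose q : laurent (iterL A n) := lmono u (- m) * g - 1.
exists (row_rcons v m), (lconst k * (1 + q)); split.
- by rewrite /= row_rcons_max col'_row_rcons.
- apply: (@tameM n.+1); first exact: tame_lconst.
  apply: (@tame_1D n.+1 q (lmono ((g : laurent _) m) m * h)).
    by rewrite subrKC mulrACA gh mulr1 lmonoMM [u * _]mulrC gmu addNr.
  have [C qC] : exists C : int, forall j : nat, low (q ^+ j) (j%:Z - C).
    apply: low_expr => i i0; rewrite lcoefD lcoefN lmonoM lcoef1.
    case: eqP => [->|i0']; last first.
      by rewrite subr0; apply/nilpMl/gm_nil; lia.
    rewrite [0 - - m](_ : _ = m); last by lia.
    by rewrite mulrC gmu subrr; exact: nilp0.
  exact: low_pow_to0 qC.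
rewrite /= row_rcons_max col'_row_rcons mulrA lmonoMM -gmE subrKC mulrA.
rewrite lmonoMM addr0 gmu subrr -[LHS]mul1r.
by congr (_ * _).
Qed.

End LeadingExponent.

(** * Every ring is a quotient of a torsion-free ring *)

Section TorsionFreeCover.

Import finmap monalg.

Section Evaluation.
Variable A : comNzRingType.

Definition cmonom_eval (m : {cmonom A}) : A := \prod_(x <- finsupp m) x ^+ m x.

Lemma cmonom_eval_widen (m : {cmonom A}) (d : {fset A}) :
  (finsupp m `<=` d)%fset -> cmonom_eval m = \prod_(x <- d) x ^+ m x.
Proof.
move=> md; apply: big_fset_incl => // x _.
by rewrite memNfinsupp => /eqP->; rewrite expr0.
Qed.

Lemma cmonom_eval_mmorphism : mmorphism cmonom_eval.
Proof.
split=> [x y|]; last by rewrite /cmonom_eval mdom1 big_seq_fset0.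
rewrite /cmonom_eval mdomD -!/(cmonom_eval _).
rewrite (cmonom_eval_widen (fsubsetUl _ (finsupp y))).
rewrite (cmonom_eval_widen (fsubsetUr (finsupp x) _)) -big_split.
by apply: eq_bigr => z _ /=; rewrite cmM exprD.
Qed.

HB.instance Definition _ :=
  isMultiplicative.Build {cmonom A} A cmonom_eval cmonom_eval_mmorphism.

Definition intr_nz : {rmorphism int -> A} := intr.

Definition malg_eval : {rmorphism {malg int[{cmonom A}]} -> A} :=
  mmap intr_nz cmonom_eval.

Lemma malg_eval_gen x : malg_eval << ucm x >>%R = x.
Proof.
rewrite /malg_eval /= mmapU /= mulr1z mul1r /cmonom_eval mdomU big_seq_fset1.
by rewrite cmUU expr1.
Qed.

Lemma malg_torsion_free (x : {malg int[{cmonom A}]}) k : x *+ k.+1 = 0 -> x = 0.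
Proof.
move=> xk; apply/malgP => m; have := congr1 (mcoeff m) xk.
by rewrite mcoeffMn mcoeff0 => /eqP; rewrite mulrn_eq0 /= => /eqP.
Qed.

End Evaluation.

(** The cover is the polynomial ring over [int] with one indeterminate for each element of [A],
    evaluated at these elements. The section sends 0 to 0 and any other element to its
    indeterminate. The zero ring is covered by [int]. *)
Lemma torsion_free_cover (A : comPzRingType) :
  exists (C : comPzRingType) (u : {rmorphism C -> A}) (s : A -> C),
  [/\ s 0 = 0, cancel s u & forall (x : C) k, x *+ k.+1 = 0 -> x = 0].
Proof.
have [A1|A1] := eqVneq (1 : A) 0.
  have A0 (x y : A) : x = y.
    by rewrite -[x]mul1r -[y]mul1r A1 !mul0r.
  have u_zmod : zmod_morphism (fun _ : int => 0 : A) by move=> x y; exact: A0.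
  have u_mon : monoid_morphism (fun _ : int => 0 : A) by split=> [|x y]; exact: A0.
  pose ua := GRing.isZmodMorphism.Build _ _ _ u_zmod.
  pose um := GRing.isMonoidMorphism.Build _ _ _ u_mon.
  pose u : {rmorphism int -> A} := HB.pack (fun _ : int => 0 : A) ua um.
  exists int, u, (fun=> 0); split=> // x k /eqP.
  by rewrite mulrn_eq0 /= => /eqP.
pose nz := GRing.PzSemiRing_isNonZero.Build A A1.
pose R : comNzRingType := HB.pack (GRing.ComPzRing.sort A) (GRing.ComPzRing.class A) nz.
have u_zmod : zmod_morphism (@malg_eval R : _ -> A) := rmorphB (@malg_eval R).
have u_mon : monoid_morphism (@malg_eval R : _ -> A).
  by split; [exact: (rmorph1 (@malg_eval R)) | exact: (rmorphM (@malg_eval R))].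
pose ua := GRing.isZmodMorphism.Build _ _ _ u_zmod.
pose um := GRing.isMonoidMorphism.Build _ _ _ u_mon.
pose u : {rmorphism {malg int[{cmonom R}]} -> A} :=
  HB.pack (@malg_eval R : _ -> A) ua um.
exists {malg int[{cmonom R}]}, u, (fun x => if x == 0 then 0 else << ucm (x : R) >>%R).
split=> [|x|]; [by rewrite eqxx | | exact: malg_torsion_free].
by case: eqP => [->|_]; [rewrite rmorph0 | exact: (@malg_eval_gen R x)].
Qed.

End TorsionFreeCover.

(** * Derivations of products, and determinants with scaled rows *)

Section DerivationProduct.
Variables (L : comPzRingType) (d : {additive L -> L}).
Hypothesis dM : forall x y, d (x * y) = x * d y + y * d x.

Lemma derivation1 : d 1 = 0.
Proof.
have := dM 1 1; rewrite !mul1r => /eqP.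
by rewrite -subr_eq subrr eq_sym => /eqP.
Qed.

Lemma derivation_prod (I : eqType) (s : seq I) (F : I -> L) : uniq s ->
  d (\prod_(k <- s) F k) = \sum_(k <- s) d (F k) * \prod_(j <- s | j != k) F j.
Proof.
elim: s => [|i s IHs] /=; first by rewrite !big_nil derivation1.
move=> /andP[is_ us]; rewrite !big_cons dM IHs// eqxx /= addrC mulrC.
congr (_ * _ + _).
  rewrite [RHS]big_seq_cond [LHS]big_seq_cond; apply: eq_bigl => j.
  by case: (boolP (j \in s)) => //= js; apply/esym; apply: contraNneq is_ => <-.
rewrite mulr_sumr; apply: eq_big_seq => k ks /=.
rewrite big_cons ifT; first by rewrite mulrCA.
by apply: contraNneq is_ => ->.
Qed.

Lemma derivation_prod_fin (I : finType) (P : pred I) (F : I -> L) :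
  d (\prod_(k | P k) F k) =
  \sum_(k | P k) d (F k) * \prod_(j | P j && (j != k)) F j.
Proof.
rewrite -big_filter derivation_prod ?filter_uniq ?index_enum_uniq// big_filter.
by apply: eq_bigr => k _; rewrite big_filter_cond.
Qed.

Lemma derivationX x k : d (x ^+ k.+1) = x ^+ k * d x *+ k.+1.
Proof.
elim: k => [|k IHk]; first by rewrite expr1 mul1r.
by rewrite exprS dM IHk mulrnAr mulrA -exprS [RHS]mulrSr.
Qed.

End DerivationProduct.

Lemma det_row_scale (R : comPzRingType) n (c : 'I_n -> R) (M : 'M[R]_n) :
  \det (\matrix_(i, j) (c i * M i j)) = (\prod_i c i) * \det M.
Proof.
rewrite -[X in _ = X * _](_ : \det (diag_mx (\row_i c i)) = _).
  rewrite -det_mulmx; congr (\det _); apply/matrixP => i j.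
  by rewrite mul_diag_mx !mxE.
by rewrite det_diag; apply: eq_bigr => i _; rewrite mxE.
Qed.

(** * Jacobians and residues of exact forms *)

Section Jacobian.
Variables (A : comPzRingType) (n : nat).
Local Notation L := (iterL A n).
Implicit Types (f g h : 'I_n -> L) (i j : 'I_n) (p q x y : L).

Definition res (x : L) : A := icoef_ x (const_mx (-1)).

Lemma res_zmod : zmod_morphism res.
Proof. by move=> x y; exact: icoefB_. Qed.
HB.instance Definition _ := GRing.isZmodMorphism.Build _ _ res res_zmod.

Lemma res_deriv i x : res (ideriv_ A i x) = 0.
Proof. by rewrite /res icoef_deriv mxE mulr0z. Qed.

(** The coefficient of $df_1\wedge\ldots\wedge df_n$ with respect to $dt_1\wedge\ldots\wedge
    dt_n$. *)
Definition jac f : L := \det (\matrix_(i, j) ideriv_ A j (f i)).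

(* Integration by parts in the factor [i0] leaves the terms with a second
   derivative of [f k]; composing the permutation with [tperm i0 k] changes their
   sign. *)
Lemma res_jac i0 f : (forall a : A, a *+ 2 = 0 -> a = 0) -> res (jac f) = 0.
Proof.
move=> tf; pose D := @ideriv_ A n.
pose G (s : 'S_n) k := res (f i0 * (D (s i0) (D (s k) (f k)) *
  \prod_(j | (j != i0) && (j != k)) D (s j) (f j))).
have byparts (s : 'S_n) :
    res (\prod_i D (s i) (f i)) = - \sum_(k | k != i0) G s k.
  rewrite (bigD1 i0)//=; apply/eqP; rewrite -addr_eq0; apply/eqP.
  rewrite -[RHS](res_deriv (s i0) (f i0 * \prod_(j | j != i0) D (s j) (f j))).
  rewrite ideriv_leibniz_ raddfD /= [RHS]addrC; congr (_ + _); first by rewrite mulrC.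
  rewrite derivation_prod_fin; last exact: ideriv_leibniz_.
  by rewrite mulr_sumr raddf_sum.
rewrite /jac /determinant raddf_sum /=.
have sgnE (s : 'S_n) x : res ((-1) ^+ s * x) = (-1) ^+ s * res x.
  by case: (odd_perm s); rewrite ?expr1 ?expr0 ?mulN1r ?mul1r// raddfN.
transitivity (\sum_(k | k != i0) - \sum_(s : 'S_n) (-1) ^+ s * G s k).
  rewrite sumrN exchange_big -sumrN; apply: eq_bigr => s _ /=.
  rewrite sgnE -mulr_sumr -mulrN -byparts; congr (_ * res _).
  by apply: eq_bigr => i _; rewrite mxE.
rewrite big1// => k k_i0; apply/eqP; rewrite oppr_eq0; apply/eqP/tf.
set S := \sum_(s : 'S_n) _; rewrite mulr2n -[X in X + _]opprK; apply/eqP.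
rewrite addrC subr_eq0; apply/eqP; rewrite /S -sumrN.
rewrite (reindex_inj (mulgI (tperm i0 k))); apply: eq_bigr => s _ /=.
rewrite odd_permM odd_tperm eq_sym k_i0 signr_addb expr1 mulN1r mulNr.
congr (- (_ * _)); rewrite /G !permM tpermL tpermR ideriv_comm.
congr (res (_ * (_ * _))); apply: eq_bigr => j /andP[ji0 jk].
by rewrite permM tpermD// eq_sym.
Qed.

End Jacobian.

(** * Residues of Jacobians multiplied by powers *)

Section JacobianPowers.

Lemma imap_res (A B : comPzRingType) (u : {rmorphism A -> B}) n (x : iterL A n) :
  res (imap u n x) = u (res x).
Proof. exact: icoef_imap. Qed.

Lemma imap_jac (A B : comPzRingType) (u : {rmorphism A -> B}) n
    (f : 'I_n -> iterL A n) : imap u n (jac f) = jac (imap u n \o f).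
Proof.
rewrite /jac -det_map_mx; congr (\det _).
by apply/matrixP => i j; rewrite !mxE imap_deriv.
Qed.

Variables (A : comPzRingType) (n : nat).
Local Notation L := (iterL A n).
Implicit Types (f g h : 'I_n -> L) (i j : 'I_n) (p q x y : L).

Lemma torsion_free_natmul (C : comPzRingType) (I : finType) (k : I -> nat) (x : C) :
  (forall (y : C) m, y *+ m.+1 = 0 -> y = 0) ->
  x *+ (\prod_i (k i).+1) = 0 -> x = 0.
Proof.
move=> tf xk; have k_gt0 : (0 < \prod_i (k i).+1)%N by exact: prodn_gt0.
by apply: (tf _ (\prod_i (k i).+1).-1); rewrite prednK.
Qed.

(* Over a torsion-free ring the form is [d] of something up to the invertible
   factor [prod (k i + 1)]; the general case is obtained by lifting the [q i]. *)
Lemma res_pow_jac i0 (k : 'I_n -> nat) (q : 'I_n -> L) :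
  res (\prod_i q i ^+ k i * jac q) = 0.
Proof.
have [C [u [s [s0 su tf]]]] := torsion_free_cover A.
have [t [tu _]] := imap_section n s0 su.
have qE : q = imap u n \o (t \o q) by apply/funext => i /=; rewrite tu.
suff E : res (\prod_i t (q i) ^+ k i * jac (t \o q)) = 0.
  rewrite -[RHS](rmorph0 u) -E -imap_res rmorphM rmorph_prod imap_jac -qE.
  congr (res (_ * _)); apply: eq_bigr => i _.
  by rewrite rmorphXn /= tu.
apply: (@torsion_free_natmul _ _ k) => //; rewrite -raddfMn.
have tf2 (a : C) : a *+ 2 = 0 -> a = 0 by exact: tf.
rewrite -(res_jac i0 (fun i => t (q i) ^+ (k i).+1) tf2); congr res.
rewrite /jac -mulrnAl -mulr_natr natr_prod -big_split /= -det_row_scale.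
congr (\det _); apply/matrixP => i j; rewrite !mxE /= mulr_natr.
rewrite (derivationX (@ideriv_leibniz_ _ _ _)).
by rewrite mulrnAl.
Qed.

(** In [p] this is a derivation of [L] which kills the constants and the [g i] with [i != i0]. *)
Definition jac_at g i0 p := jac (fun i => if i == i0 then p else g i).

Lemma jac_at_id g i0 : jac_at g i0 (g i0) = jac g.
Proof. by congr jac; apply/funext => i; case: eqP => [->|]. Qed.

Lemma jac_at_ext g h i0 p : (forall i, i != i0 -> g i = h i) ->
  jac_at g i0 p = jac_at h i0 p.
Proof. by move=> gh; congr jac; apply/funext => i; case: eqP => // /eqP/gh. Qed.

Lemma jac_at_expand g i0 : exists C : 'I_n -> L,
  forall p, jac_at g i0 p = \sum_j ideriv_ A j p * C j.
Proof.
pose M p : 'M[L]_n := \matrix_(i, j) ideriv_ A j (if i == i0 then p else g i).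
exists (cofactor (M 0) i0) => p; rewrite /jac_at /jac (expand_det_row _ i0).
apply: eq_bigr => j _; rewrite mxE eqxx; congr (_ * _).
rewrite /cofactor; congr (_ * \det _); apply/matrixP => k l; rewrite !mxE.
by rewrite eq_sym (negPf (neq_lift _ _)).
Qed.

Lemma jac_at_zmod g i0 : zmod_morphism (jac_at g i0).
Proof.
move=> x y; have [C CE] := jac_at_expand g i0; rewrite !CE -sumrB.
by apply: eq_bigr => j _; rewrite raddfB mulrBl.
Qed.
HB.instance Definition _ g i0 :=
  GRing.isZmodMorphism.Build L L (jac_at g i0) (jac_at_zmod g i0).

Lemma jac_at_leibniz g i0 x y :
  jac_at g i0 (x * y) = x * jac_at g i0 y + y * jac_at g i0 x.
Proof.
have [C CE] := jac_at_expand g i0; rewrite !CE !mulr_sumr -big_split.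
by apply: eq_bigr => j _; rewrite ideriv_leibniz_ mulrDl !mulrA.
Qed.

Lemma jac_at1 g i0 : jac_at g i0 1 = 0.
Proof. exact/derivation1/jac_at_leibniz. Qed.

Lemma jac_at_const g i0 a : jac_at g i0 (iconst_ A n a) = 0.
Proof.
have [C CE] := jac_at_expand g i0; rewrite CE big1// => j _.
by rewrite ideriv_const mul0r.
Qed.

Lemma jac_at_other g i0 i : i != i0 -> jac_at g i0 (g i) = 0.
Proof.
move=> ii0; apply: (determinant_alternate ii0) => j.
by rewrite !mxE eqxx (negPf ii0).
Qed.

Lemma jac_atX0 g i0 x k : jac_at g i0 x = 0 -> jac_at g i0 (x ^+ k) = 0.
Proof.
move=> x0; elim: k => [|k IHk]; first by rewrite expr0 jac_at1.
by rewrite exprS jac_at_leibniz x0 IHk !mulr0 addr0.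
Qed.

(* With [q = q' * prod g_i^(b_i)], the factors [h_i^(b_i) = g_i^(- b_i)] are
   absorbed, since multiplying [q] by a power of [g_i] multiplies the form
   by the same power. *)
Lemma res_jac_at_units g h i0 q k (c b : 'I_n -> nat) :
  (forall i, i != i0 -> g i * h i = 1) ->
  res (q ^+ k * \prod_(i | i != i0) (g i ^+ c i * h i ^+ b i) * jac_at g i0 q) = 0.
Proof.
move=> gh; pose G := \prod_(i | i != i0) g i ^+ b i.
pose H := \prod_(i | i != i0) h i ^+ b i.
have GH : G * H = 1.
  by rewrite -big_split big1// => i /gh /= E; rewrite -exprMn E expr1n.
have G0 : jac_at g i0 G = 0.
  rewrite /G; apply: (big_ind (fun x => jac_at g i0 x = 0)) => [|x y x0 y0|i ii0].
  - exact: jac_at1.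
  - by rewrite jac_at_leibniz x0 y0 !mulr0 addr0.
  - exact/jac_atX0/jac_at_other.
pose q' := q * H; have qE : q = G * q' by rewrite mulrCA GH mulr1.
pose Q i := if i == i0 then q' else g i.
rewrite -(res_pow_jac i0 (fun i => if i == i0 then k else c i + b i * k)%N Q).
congr res; rewrite [X in _ = X * _](bigD1 i0)//= /Q eqxx -/Q.
have -> : jac Q = jac_at g i0 q' by [].
rewrite {2}qE jac_at_leibniz G0 mulr0 addr0 {1}qE exprMn.
rewrite -[X in _ = _ * X * _](_ : \prod_(i | i != i0) (g i ^+ c i * h i ^+ b i) *
    (G ^+ k * G) = _); first by ring.
rewrite -exprSr -prodrXl -big_split /=; apply: eq_bigr => i ii0.
rewrite (negPf ii0) exprD exprM exprSr -!mulrA; congr (_ * _).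
by rewrite mulrCA [h i ^+ _ * _]mulrC -exprMn gh// expr1n mulr1.
Qed.

End JacobianPowers.

(** * Residues of logarithmic forms *)

Section TameUnits.
Variables (A : comPzRingType) (n : nat).
Local Notation L := (iterL A n).
Implicit Types (f g h : 'I_n -> L) (i j : 'I_n) (p q x y : L).

Lemma res_small : exists lam : Lambda n, forall x : L, small lam x -> res x = 0.
Proof.
have [lam lamP] := Zlam_point (const_mx 1 : 'rV[int]_n); exists lam => x /(_ _ lamP).
by rewrite /res; congr (icoef_ x _ = 0); apply/rowP => i; rewrite !mxE.
Qed.

Lemma res_mul_small (F : L) :
  exists lam : Lambda n, forall x, small lam x -> res (F * x) = 0.
Proof.
have [lam lamP] := res_small; have [mu muP] := small_mul F lam.
by exists mu => x /muP; exact: lamP.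
Qed.

Lemma inverse_unique x y z : x * y = 1 -> x * z = 1 -> y = z.
Proof. by move=> xy xz; rewrite -[y]mulr1 -xz mulrCA mulrA xy mul1r. Qed.

Lemma tame_unit x : tame x -> exists y, x * y = 1.
Proof.
elim=> [a b ab|q u qu _|s t _ [y sy] _ [z tz]].
- by exists (iconst_ A n b); rewrite -rmorphM ab rmorph1.
- by exists u.
- by exists (y * z); rewrite mulrACA sy tz mulr1.
Qed.

(* For [x = 1 + q], [dlog x] is the sum of the [(- q)^j dq], each handled by
   [res_jac_at_units], and of a remainder which tends to 0. *)
Lemma res_dlog_tame g h i0 x y : (forall i, i != i0 -> g i * h i = 1) ->
  tame x -> x * y = 1 -> res (\prod_(i | i != i0) h i * y * jac_at g i0 x) = 0.
Proof.
move=> gh tx; set W := \prod_(i | _) _.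
elim: tx y => [a b ab|q u qu q0|s t st IHs tt IHt] y xy.
- by rewrite jac_at_const mulr0 raddf0.
- rewrite (inverse_unique xy qu) raddfD /= jac_at1 add0r.
  have [lam lamP] := res_mul_small (W * u * jac_at g i0 q).
  have [J JP] := q0 lam.
  (* The inverse of [1 + q] as a finite geometric sum with remainder; [J] is so large that the
     remainder contributes no residue. *)
  have uE : u = \sum_(j < J) (- q) ^+ j + (- q) ^+ J * u.
    have E : (1 + q) * (\sum_(j < J) (- q) ^+ j) = 1 - (- q) ^+ J.
      by rewrite -[RHS]opprB subrX1 -mulNr opprB opprK.
    rewrite -[X in X + _]mul1r -qu mulrAC E mulrBl mul1r subrK //.
  rewrite {1}uE mulrDr mulrDl raddfD /= exprNn.
  rewrite [X in _ + res X](_ : _ = (-1) ^+ J * (W * u * jac_at g i0 q * q ^+ J)).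
    have sgn (k : nat) z : res ((-1) ^+ k * z) = (-1) ^+ k * res z.
      rewrite -signr_odd -[in RHS]signr_odd.
      by case: (odd k); rewrite ?expr1 ?expr0 ?mulN1r ?mul1r// raddfN.
    rewrite sgn (lamP _ (JP _ (leqnn _))) mulr0 addr0 [W * _]mulr_sumr mulr_suml.
    rewrite raddf_sum big1// => j _ /=.
    rewrite exprNn mulrCA -mulrA sgn [W * _]mulrC.
    have := res_jac_at_units q j (fun=> 0%N) (fun=> 1%N) gh.
    rewrite [X in _ * X * _](_ : _ = W) => [->|]; first by rewrite mulr0.
    by apply: eq_bigr => i _; rewrite expr0 mul1r expr1.
  by ring.
- have [s' ss'] := tame_unit st; have [t' tt'] := tame_unit tt.
  have yE : y = s' * t'.
    by apply: (inverse_unique xy); rewrite mulrACA ss' tt' mulr1.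
  rewrite jac_at_leibniz yE mulrDr.
  rewrite [X in res (X + _)](_ : _ = W * t' * jac_at g i0 t * (s * s')); last by ring.
  rewrite [X in res (_ + X)](_ : _ = W * s' * jac_at g i0 s * (t * t')); last by ring.
  by rewrite ss' tt' !mulr1 raddfD /= IHt// IHs// addr0.
Qed.

Lemma imono_prod (I : finType) (P : pred I) (v : I -> 'rV[int]_n) :
  \prod_(i | P i) imono 1 (v i) = imono 1 (\sum_(i | P i) v i) :> L.
Proof.
elim/big_rec2: _ => [|i y x _ ->]; first by rewrite imono1.
by rewrite imonoM mulr1.
Qed.

(** The logarithmic derivative of $t^{v_i}$ with respect to $t_j$ is $v_{ij}t_j^{-1}$, so the
    determinant is $\det(v_{ij})\,t^{(-1,\ldots,-1)}$. *)
Lemma res_dlog_imono (v : 'I_n -> 'rV[int]_n) :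
  res (\prod_i imono 1 (- v i) * jac (fun i => imono 1 (v i) : L)) =
  (\det (\matrix_(i, j) v i 0 j))%:~R.
Proof.
rewrite /jac -det_row_scale.
pose N : 'M[L]_n := \matrix_(i, j) (v i 0 j)%:~R.
pose t : 'rV[L]_n := \row_j imono 1 (- delta_mx 0 j).
rewrite [X in \det X](_ : _ = N *m diag_mx t); last first.
  apply/matrixP => i j; rewrite mul_mx_diag !mxE ideriv_imono mulrzAr imonoM.
  by rewrite mulr1 addKr mulrzl.
rewrite det_mulmx det_diag (eq_bigr (fun j => imono 1 (- delta_mx 0 j))); last first.
  by move=> j _; rewrite mxE.
have -> : N = map_mx intr (\matrix_(i, j) v i 0 j).
  by apply/matrixP => i j; rewrite !mxE.
rewrite det_map_mx imono_prod mulrzl /res icoef_Mz icoef_imono ifT//.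
apply/eqP/rowP => j; rewrite summxE mxE (bigD1 j)//= big1 => [|i ij].
  by rewrite !mxE !eqxx addr0.
by rewrite !mxE eq_sym (negPf ij) oppr0.
Qed.

(** The units are replaced by their monomials one at a time. The product rule splits
    $d\log(t^{v_i}k_i)$ into $d\log t^{v_i}+d\log k_i$, and the tame part contributes nothing by
    [res_dlog_tame]. *)
Lemma res_dlog_units g h (v : 'I_n -> 'rV[int]_n) (k : 'I_n -> L) :
  (forall i, g i * h i = 1) -> (forall i, tame (k i)) ->
  (forall i, g i = imono 1 (v i) * k i) ->
  res (\prod_i h i * jac g) = (\det (\matrix_(i, j) v i 0 j))%:~R.
Proof.
move=> gh kt gE; rewrite -res_dlog_imono.
have mono1 i : imono 1 (v i) * imono 1 (- v i) = 1 :> L.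
  by rewrite imonoM mulr1 subrr imono1.
(* [F m] has its first [m] entries already replaced by monomials, and [H m] consists of the
   inverses. *)
pose F m i := if (i < m)%N then imono 1 (v i) : L else g i.
pose H m i := if (i < m)%N then imono 1 (- v i) : L else h i.
have FH m i : F m i * H m i = 1 by rewrite /F /H; case: ifP.
suff E m : (m <= n)%N -> res (\prod_i h i * jac g) = res (\prod_i H m i * jac (F m)).
  rewrite (E n)//; congr (res (_ * jac _)); last first.
    by apply/funext => i; rewrite /F ltn_ord.
  by apply: eq_bigr => i _; rewrite /H ltn_ord.
elim: m => [|m IHm] mn; first by congr (res (_ * jac _)).
rewrite IHm 1?ltnW//; pose i0 := Ordinal mn.
have off i : i != i0 -> (i < m)%N = (i < m.+1)%N.
  by rewrite -val_eqE /= => im; lia.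
have HD m' : \prod_i H m' i = H m' i0 * \prod_(i | i != i0) H m' i.
  by rewrite (bigD1 i0).
have Hm : H m i0 = h i0 by rewrite /H /= ltnn.
have HSm : H m.+1 i0 = imono 1 (- v i0) by rewrite /H /= ltnSn.
rewrite !HD Hm HSm (eq_bigr (H m.+1)) => [|i ii0]; last by rewrite /H (off i).
set W := \prod_(i | _) _.
have -> : jac (F m) = jac_at (F m.+1) i0 (imono 1 (v i0) * k i0).
  rewrite -gE -(jac_at_id _ i0) {2}/F /= ltnn; apply: jac_at_ext => i ii0.
  by rewrite /F (off i).
have -> : jac (F m.+1) = jac_at (F m.+1) i0 (imono 1 (v i0)).
  by rewrite -(jac_at_id _ i0) {2}/F /= ltnSn.
have [k' kk'] := tame_unit (kt i0).
have -> : h i0 = imono 1 (- v i0) * k'.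
  by apply: (inverse_unique (gh i0)); rewrite gE mulrACA mono1 kk' mulr1.
rewrite jac_at_leibniz.
rewrite [X in res X](_ : _ = W * k' * jac_at (F m.+1) i0 (k i0) *
     (imono 1 (v i0) * imono 1 (- v i0)) +
   imono 1 (- v i0) * W * jac_at (F m.+1) i0 (imono 1 (v i0)) * (k i0 * k')).
  rewrite mono1 kk' !mulr1 raddfD /= /W.
  by rewrite (@res_dlog_tame (F m.+1) (H m.+1) i0)// add0r.
by ring.
Qed.

End TameUnits.

(** * Order-preserving matrices for the lexicographic order *)

Lemma lexposP n (v : 'rV[int]_n) :
  lexpos v <-> exists i, 0 < v 0 i /\ forall j : 'I_n, (i < j)%N -> v 0 j = 0.
Proof.
elim: n v => [|n IHn] v /=; first by split=> // -[[]].
have lt_lift (i j : 'I_n) : (lift ord_max i < lift ord_max j)%N = (i < j)%N.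
  by rewrite !lift_max.
split=> [[v0|[v0 /IHn[i [vi v_gt]]]]|[i [vi v_gt]]].
- by exists ord_max; split=> // j; have := ltn_ord j; rewrite /=; lia.
- exists (lift ord_max i); split; first by move: vi; rewrite mxE.
  move=> j; case: (unliftP ord_max j) => [k ->|->//]; rewrite lt_lift => ik.
  by have := v_gt k ik; rewrite mxE.
case: (unliftP ord_max i) vi v_gt => [k ->|->]; last by left.
move=> vk v_gt; right; split.
  by apply: v_gt; rewrite lift_max /=.
by apply/IHn; exists k; rewrite mxE; split=> // j kj; rewrite mxE v_gt// lt_lift.
Qed.

Lemma lexpos0 n : ~ lexpos (0 : 'rV[int]_n).
Proof. by move=> /lexposP[i []]; rewrite mxE ltxx. Qed.

Lemma lexpos_delta n (i : 'I_n) : lexpos (delta_mx 0 i).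
Proof.
apply/lexposP; exists i; rewrite mxE !eqxx; split=> // j ij.
by rewrite mxE /=; case: eqP => // jiE; rewrite jiE ltnn in ij.
Qed.

(* An order-preserving endomorphism of the lexicographically ordered group
   [int^n] preserves the chain of convex subgroups, hence is triangular. *)
Lemma lexpos_det1 n (N M : 'M[int]_n) :
  (forall v : 'rV[int]_n, lexpos v -> lexpos (v *m N)) -> M *m N = 1%:M ->
  \det N = 1.
Proof.
move=> Npos MN.
(* [t i] is the column of the last nonzero entry of row [i], the image of a positive basis
   vector. *)
have /choice[t tP] i : exists j, 0 < N i j /\ forall k : 'I_n, (j < k)%N -> N i k = 0.
  have /Npos/lexposP[j [Nj jP]] := lexpos_delta i; exists j.
  by move: Nj; rewrite -rowE mxE; split=> // k /jP; rewrite -rowE mxE.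
have t_incr (i j : 'I_n) : (i < j)%N -> (t i < t j)%N.
  move=> ij; rewrite ltnNge; apply/negP => tji.
  have [Ni i0] := tP i; have [Nj j0] := tP j.
  (* If [t j <= t i], the vector $e_j-ke_i$ is positive, but with [k] this large its image has a
     negative last nonzero entry, in column [t i]. *)
  pose k := (absz (N j (t i))).+1.
  have vpos : lexpos (delta_mx 0 j - delta_mx 0 i *+ k : 'rV[int]_n).
    apply/lexposP; exists j; rewrite !mxE mulmxnE !mxE !eqxx /=.
    have -> : (j == i) = false by apply/eqP => jiE; rewrite jiE ltnn in ij.
    split; first by rewrite mulr0n mul0rn subr0.
    move=> m jm; rewrite !mxE mulmxnE !mxE /=.
    have -> : (m == j) = false by apply/eqP => mjE; rewrite mjE ltnn in jm.
    have -> : (m == i) = false by apply/eqP => miE; move: jm; rewrite miE; lia.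
    by rewrite mulr0n mul0rn subr0.
  have /lexposP[m []] := Npos _ vpos.
  have vE l : ((delta_mx 0 j - delta_mx 0 i *+ k : 'rV[int]_n) *m N) 0 l = N j l - N i l *+ k.
    by rewrite mulmxBl -[_ *+ k]scaler_nat -scalemxAl scaler_nat -!rowE !mxE mulmxnE !mxE.
  rewrite vE => Nm m0; have [lt_m|m_lt|/val_inj mE] := ltngtP m (t i).
  - have := m0 _ lt_m; rewrite vE /k => E; nia.
  - by move: Nm; rewrite i0// j0 ?mul0rn ?subrr ?ltxx//; lia.
  - by move: Nm; rewrite mE /k; nia.
(* A strictly increasing self-map of the indices lies below the identity, by descending induction
   from the last index; so [N] is triangular. *)
have t_le (d : nat) (i : 'I_n) : (i + d)%N = n.-1 -> (t i <= i)%N.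
  elim: d i => [|d IHd] i idn; first by have := ltn_ord (t i); lia.
  have i1 : (i.+1 < n)%N by lia.
  by have := t_incr i (Ordinal i1) (leqnn _); have := IHd (Ordinal i1); rewrite /=; lia.
have {}t_le i : (t i <= i)%N by apply: (t_le (n.-1 - i)%N); have := ltn_ord i; lia.
have N_trig : is_trig_mx N.
  by apply/is_trig_mxP => i j ij; apply: (tP i).2; exact: leq_ltn_trans ij.
have : 0 <= \det N.
  rewrite det_trig//; apply: prodr_ge0 => i _; have [Ni i0] := tP i.
  have := t_le i; rewrite leq_eqVlt => /orP[/eqP/val_inj tiE|/i0->//].
  by rewrite -{2}tiE ltW.
(* An integer that is nonnegative and invertible equals 1. *)
have := congr1 determinant MN; rewrite det_mulmx det1.
by move: (\det M) (\det N) => m d md d0; have [m0|m0] := leP m 0; nia.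
Qed.

(** * Continuous endomorphisms and their degree *)

Section Endomorphisms.
Variables (A : comPzRingType) (n : nat).
Local Notation L := (iterL A n).
Implicit Types (phi psi : {rmorphism L -> L}) (x y : L).

Definition cont_alg (phi : L -> L) : Prop :=
  (forall a, phi (iconst_ A n a) = iconst_ A n a) /\
  (forall lam, exists mu, forall x : L, small mu x -> small lam (phi x)).

Definition tvar (i : 'I_n) : L := imono 1 (delta_mx 0 i).
Definition tvarV (i : 'I_n) : L := imono 1 (- delta_mx 0 i).

Lemma tvarK i : tvar i * tvarV i = 1.
Proof. by rewrite /tvar /tvarV imonoM mulr1 subrr imono1. Qed.

Lemma imono_tvar (l : 'rV[int]_n) (c b : 'I_n -> nat) :
  (forall i, l 0 i = (c i)%:Z - (b i)%:Z) ->
  imono 1 l = \prod_i (tvar i ^+ c i * tvarV i ^+ b i).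
Proof.
move=> lcb; under eq_bigr => i _ do
  rewrite /tvar /tvarV !imonoX imonoM !expr1n mulr1.
rewrite imono_prod; congr imono; apply/rowP => j.
rewrite summxE (bigD1 j)//= big1 => [|i ij]; rewrite !mxE !mulmxnE !mxE.
  by rewrite !eqxx addr0 lcb mulNrn !natz.
by rewrite eq_sym (negPf ij) /= oppr0 !mul0rn addr0.
Qed.

(* [res (dlog (phi t_1) /\ ... /\ dlog (phi t_n))] *)
Definition degree phi : A :=
  res (\prod_i phi (tvarV i) * jac (phi \o tvar)).

Lemma res_constM a x : res (iconst_ A n a * x) = a * res x.
Proof. exact: icoef_constM. Qed.

(** At an index [i0] with [l 0 i0 != -1], a nonnegative exponent gives $f^k\,df$, and an exponent
    $-k-2$ gives $f^{-k-2}df=-h^k\,dh$ with $h=1/f$. Both fall under [res_jac_at_units], the other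
    variables entering through the positive and negative parts [c] and [b] of their exponents. *)
Lemma res_endo_imono phi (l : 'rV[int]_n) : l <> const_mx (-1) ->
  res (phi (imono 1 l) * jac (phi \o tvar)) = 0.
Proof.
move=> l1; pose f i := phi (tvar i); pose h i := phi (tvarV i).
have fh i : f i * h i = 1 by rewrite -rmorphM tvarK rmorph1.
have [i0 li0] : exists i0, l 0 i0 != -1.
  apply/existsP; apply: contra_notT l1; rewrite negb_exists => /forallP l1.
  by apply/rowP => i; rewrite mxE; apply/eqP; rewrite -[_ == _]negbK.
pose c i := if 0 <= l 0 i then absz (l 0 i) else 0%N.
pose b i := if 0 <= l 0 i then 0%N else absz (l 0 i).
have lcb i : l 0 i = (c i)%:Z - (b i)%:Z by rewrite /c /b; case: ifP; lia.
rewrite (imono_tvar lcb) rmorph_prod.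
under eq_bigr => i _ do rewrite rmorphM !rmorphXn.
rewrite (bigD1 i0)//=; set W := \prod_(i | _) _.
have [l0|l0] := leP 0 (l 0 i0).
  have -> : b i0 = 0%N by rewrite /b l0.
  rewrite expr0 mulr1 -(jac_at_id _ i0) /=.
  by apply: (@res_jac_at_units _ _ f h) => i _; exact: fh.
have -> : c i0 = 0%N by rewrite /c leNgt l0.
have [k ->] : exists k, b i0 = k.+2.
  by exists (b i0 - 2)%N; rewrite /b leNgt l0 /=; move: li0 l0; lia.
rewrite expr0 mul1r -(jac_at_id _ i0) /= -/(f i0) -/(h i0).
have -> : jac_at (phi \o tvar) i0 (f i0) = - (f i0 * f i0 * jac_at f i0 (h i0)).
  have := jac_at_leibniz f i0 (f i0) (h i0); rewrite fh jac_at1 => E.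
  rewrite -[LHS]mul1r -(fh i0) -mulrA.
  have /eqP := esym E; rewrite addrC addr_eq0 => /eqP E'.
  by rewrite [h i0 * _]E' mulrN mulrA.
have := @res_jac_at_units _ _ f h i0 (h i0) k c b (fun i _ => fh i).
rewrite -/W => E; rewrite -[RHS]oppr0 -E -raddfN; congr res.
rewrite mulrN; congr (- _); rewrite !exprS.
rewrite [LHS](_ : _ = (f i0 * h i0) * (f i0 * h i0) *
  (h i0 ^+ k * W * jac_at f i0 (h i0))); last by ring.
by rewrite fh !mul1r.
Qed.

(** The difference [T] of the two sides is additive and vanishes on a neighborhood of zero, so
    [dense_eq0] reduces the claim to monomials; there only the exponent $(-1,\ldots,-1)$
    contributes, with value [degree phi]. *)
Lemma res_endo phi x : cont_alg phi ->
  res (phi x * jac (phi \o tvar)) = degree phi * res x.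
Proof.
move=> [phiC phi_cont]; set J := jac _.
pose T x := res (phi x * J) - degree phi * res x.
have T_zmod : zmod_morphism T.
  by move=> y z; rewrite /T !raddfB mulrBl raddfB /= mulrBr; ring.
pose Ta := GRing.isZmodMorphism.Build _ _ T T_zmod.
pose TT : {additive L -> A} := HB.pack T Ta.
have [lam1 lam1P] := @res_mul_small A n J.
have [mu1 mu1P] := phi_cont lam1.
have [mu2 mu2P] := @res_small A n.
have [nu nuP] := ZlamU mu1 mu2.
apply/eqP; rewrite -subr_eq0; apply/eqP.
apply: (@dense_eq0 _ _ _ TT nu) => [g gnu|l]; rewrite /= /T.
  have g1 : small mu1 g by apply: small_sub gnu => m mm; apply: nuP; left.
  have g2 : small mu2 g by apply: small_sub gnu => m mm; apply: nuP; right.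
  by rewrite mulrC lam1P ?mu2P ?mulr0 ?subr0//; exact: mu1P.
rewrite imonoE rmorphM phiC -mulrA !res_constM mulrCA -mulrBr.
have [->|/eqP l1] := eqVneq l (const_mx (-1)); last first.
  rewrite res_endo_imono// [res _]icoef_imono eq_sym.
  by case: eqP => [/l1//|_]; rewrite mulr0 subrr mulr0.
rewrite [res (imono _ _)]icoef_imono eqxx mulr1 /degree -/J.
rewrite (@imono_tvar _ (fun=> 0%N) (fun=> 1%N)) => [|i]; last by rewrite mxE.
rewrite rmorph_prod (eq_bigr (fun i => phi (tvarV i))) ?subrr ?mulr0// => i _.
by rewrite expr0 mul1r expr1.
Qed.

Lemma endo_pow_to0 phi x : cont_alg phi -> pow_to0 x -> pow_to0 (phi x).
Proof.
move=> [_ phi_cont] x0 lam; have [mu muP] := phi_cont lam.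
by have [J JP] := x0 mu; exists J => j Jj; rewrite -rmorphXn; exact/muP/JP.
Qed.

(* A unit [g] tends to 0 under powers iff its leading exponent is positive, so a
   bicontinuous automorphism preserves the sign of leading exponents. *)
Lemma degree_connected phi psi : connected_ring A -> 1 <> 0 :> A ->
  cont_alg phi -> cont_alg psi -> cancel phi psi -> cancel psi phi ->
  degree phi = 1.
Proof.
move=> A_conn A_nz phi_ca psi_ca phiK psiK.
have unit_lead' := @unit_lead A A_conn A_nz n.
have lead_inj' := @lead_inj A A_nz n.
have monoV l : imono 1 l * imono 1 (- l) = 1 :> L.
  by rewrite imonoM mulr1 subrr imono1.
have phi_monoV l : phi (imono 1 l) * phi (imono 1 (- l)) = 1.
  by rewrite -rmorphM monoV rmorph1.
have /choice[w wP] l : exists v, exists k,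
    [/\ lead (phi (imono 1 l)) v, tame k & phi (imono 1 l) = imono 1 v * k].
  exact: unit_lead' (phi_monoV l).
have w_lead l : lead (phi (imono 1 l)) (w l) by have [k []] := wP l.
(* Uniqueness of leading exponents makes [w] additive, hence given by an integer matrix [N]. *)
have wD l m : w (l + m) = w l + w m.
  apply: lead_inj' (w_lead _) _.
  rewrite (_ : imono 1 (l + m) = imono 1 l * imono 1 m); last by rewrite imonoM mulr1.
  by rewrite rmorphM; exact: leadM.
have w_zmod : zmod_morphism w.
  by move=> l m; apply/eqP; rewrite eq_sym subr_eq -wD subrK.
pose wa := GRing.isZmodMorphism.Build _ _ w w_zmod.
pose W : {additive 'rV[int]_n -> 'rV[int]_n} := HB.pack w wa.
pose N : 'M[int]_n := \matrix_i w (delta_mx 0 i).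
have wE l : w l = l *m N.
  rewrite mulmx_sum_row {1}[l]row_sum_delta -[w _]/(W _) raddf_sum.
  apply: eq_bigr => i _; rewrite rowK -[l 0 i]intz !scaler_int.
  exact: (raddfMz W).
have Npos l : lexpos l -> lexpos (l *m N).
  move=> l0; rewrite -wE; have := @lead_not_pow_to0 A A_nz n _ _ (w_lead l).
  have phi0 : pow_to0 (phi (imono 1 l)).
    by apply: endo_pow_to0 => //; exact: lead_pow_to0 (lead_imono _ l) l0.
  by move=> H; apply: contrapT => /H; apply.
(* If the leading exponent of [phi x] were not 0, then that of [phi x] or of [phi y] would be
   positive and its powers would tend to 0; applying [psi], so would those of [x] or [y], whose
   leading exponents are 0. *)
have lead0_phi x y : x * y = 1 -> lead x 0 -> lead (phi x) 0.
  move=> xy x_lead; have phixy : phi x * phi y = 1 by rewrite -rmorphM xy rmorph1.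
  have [v [_ [phix_lead _ _]]] := unit_lead' _ _ phixy.
  have no_pow z : lead z 0 -> ~ pow_to0 (phi z).
    move=> z0 phiz; apply: (@lead_not_pow_to0 A A_nz n _ _ z0 (@lexpos0 n)).
    by rewrite -[z]phiK; exact: endo_pow_to0.
  have yx : y * x = 1 by rewrite mulrC.
  have y_lead : lead y 0.
    have [u [_ [yu _ _]]] := unit_lead' _ _ yx.
    have := leadM x_lead yu; rewrite xy add0r => /(lead_inj' _ _ _ (lead1 _ _)).
    by move=> u0; rewrite u0.
  have [v0|vpos|vneg] := lexpos_trichotomy v; first by rewrite -v0.
    by case: (no_pow x x_lead); exact: lead_pow_to0 phix_lead vpos.
  case: (no_pow y y_lead); apply: lead_pow_to0 vneg.
  have phiyx : phi y * phi x = 1 by rewrite mulrC.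
  have [u [_ [phiy_lead _ _]]] := unit_lead' _ _ phiyx.
  have := leadM phix_lead phiy_lead; rewrite phixy => /(lead_inj' _ _ _ (lead1 _ _)).
  by move=> /esym/eqP; rewrite addrC addr_eq0 => /eqP <-.
(* The rows of an inverse of [N] are the leading exponents of the [psi (tvar i)]: the cofactor [k']
   has leading exponent 0, and so does its image under [phi]. *)
have /choice[m mP] i : exists v : 'rV[int]_n, v *m N = delta_mx 0 i.
  have psi_unit : psi (tvar i) * psi (tvarV i) = 1 by rewrite -rmorphM tvarK rmorph1.
  have [v [k [v_lead k_tame psiE]]] := unit_lead' _ _ psi_unit; exists v.
  pose k' := imono 1 (- v) * psi (tvar i).
  have k'E : psi (tvar i) = imono 1 v * k' by rewrite mulrA monoV mul1r.
  have k'_lead : lead k' 0.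
    by rewrite -[0](addNr v); apply: leadM => //; exact: lead_imono.
  have k'_unit : k' * (imono 1 v * psi (tvarV i)) = 1.
    by rewrite mulrACA [imono 1 (- v) * _]mulrC monoV psi_unit mulr1.
  rewrite -wE -[w v]addr0; apply: lead_inj' (lead_imono _ _).
  rewrite -[imono 1 _]/(tvar i) -[tvar i]psiK k'E rmorphM.
  by apply: leadM => //; exact: lead0_phi k'_unit k'_lead.
have detN : \det N = 1.
  apply: (@lexpos_det1 _ N (\matrix_i m i)) => //; apply/row_matrixP => i.
  by rewrite row_mul rowK mP rowE mulmx1.
rewrite /degree.
have /choice[k kP] i : exists k, tame k /\ phi (tvar i) = imono 1 (w (delta_mx 0 i)) * k.
  by have [k [_ kt kE]] := wP (delta_mx 0 i); exists k.
rewrite (@res_dlog_units _ _ _ _ (fun i => w (delta_mx 0 i)) k).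
- by rewrite [X in \det X](_ : _ = N) ?detN.
- by move=> i; exact: phi_monoV.
- by move=> i; have [] := kP i.
- by move=> i; have [] := kP i.
Qed.

End Endomorphisms.

(** * Quotient rings *)

Section QuotientRing.
Variables (A : comPzRingType) (X : set A^o).

(** The ideal generated by [X] is the submodule [span X] of [A] as a module over itself, so the
    quotient module only has to be given a product. *)
Definition ring_quot : Type := lquot X.
HB.instance Definition _ := GRing.Lmodule.on ring_quot.

Definition qmul (x y : ring_quot) : ring_quot := lpi X (lrepr x * lrepr y).

Lemma qmulE (a b : A^o) : qmul (lpi X a) (lpi X b) = lpi X (a * b : A).
Proof.
have E (c d : A^o) : lpi X (lrepr (lpi X c) * d : A) = lpi X (c * d : A).
  rewrite mulrC [in RHS]mulrC -![d * _]/(d *: _ : A^o).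
  by rewrite !linearZ /= lreprK.
by rewrite /qmul E mulrC E mulrC.
Qed.

Lemma qmulA : associative qmul.
Proof.
move=> x y z; rewrite -[x]lreprK -[y]lreprK -[z]lreprK !qmulE.
by rewrite mulrA.
Qed.

Lemma qmulC : commutative qmul.
Proof. by move=> x y; rewrite /qmul mulrC. Qed.

Lemma qmul1 : left_id (lpi X (1 : A)) qmul.
Proof. by move=> x; rewrite -[x]lreprK qmulE mul1r. Qed.

Lemma qmulDl : left_distributive qmul +%R.
Proof.
move=> x y z; rewrite -[x]lreprK -[y]lreprK -[z]lreprK -raddfD !qmulE.
by rewrite -raddfD mulrDl.
Qed.

HB.instance Definition _ :=
  GRing.Zmodule_isComPzRing.Build ring_quot qmulA qmulC qmul1 qmulDl.

Definition qpi (a : A) : ring_quot := lpi X a.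

Lemma qpi_zmod : zmod_morphism qpi.
Proof. exact: (@lpi_zmod A A^o X). Qed.

Lemma qpi_monoid : monoid_morphism qpi.
Proof. by split=> // a b; rewrite [RHS]qmulE. Qed.

HB.instance Definition _ := GRing.isZmodMorphism.Build A ring_quot qpi qpi_zmod.
HB.instance Definition _ := GRing.isMonoidMorphism.Build A ring_quot qpi qpi_monoid.

Lemma qpi_eq0 a : qpi a = 0 <-> span X a.
Proof.
rewrite -[0](raddf0 qpi); split; first by move=> /lpi_eq; rewrite subr0.
by move=> aX; apply/lpi_eq; rewrite subr0.
Qed.

End QuotientRing.

(** * Connected quotients that separate elements from zero *)

Section ConnectedQuotient.
Variable A : comPzRingType.
Implicit Types (X Y : set A^o) (x y : A).

Lemma span_incl X Y y : X `<=` Y -> span X y -> span Y y.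
Proof.
move=> XY; elim=> [|a u v Xu _ IH]; [exact: span0 | apply: span_lin => //; exact: XY].
Qed.

Lemma span_setU1 X a y : span (X `|` [set a]) y -> exists c, span X (y - c * a : A).
Proof.
elim=> [|b u v [Xu|->] _ [c cP]].
- by exists 0; rewrite mul0r subr0; exact: span0.
- by exists c; rewrite -addrA; exact: span_lin.
- exists (c + b); rewrite -[b *: _]/(b * a).
  by rewrite (_ : _ - _ = v - c * a); last by ring.
Qed.

(* If the ideal generated by [X] is maximal among those not containing [x], every
   nonzero ideal of the quotient contains the image of [x]. *)
Lemma connected_quotient x : x <> 0 -> exists (B : comPzRingType)
  (u : {rmorphism A -> B}) (s : B -> A),
  [/\ s 0 = 0, cancel s u, connected_ring B & u x <> 0].
Proof.
move=> x0; have [|X [Xx Xmax]] := @Zorn_bigcup A (fun X => ~ @span A A^o X x).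
  move=> F FP Ftot xF.
  (* A combination of elements from a chain uses a single member of it; the empty combination is the
     case [x = 0]. *)
  suff [[Y FY Yx]|x00] : (exists2 Y, F Y & @span A A^o Y x) \/ x = 0.
  - exact: FP FY Yx.
  - exact: x0.
  elim: xF => [|a u v [Y FY Yu] _ [[Z FZ Zv]|->]]; first by right.
    have [YZ|ZY] := Ftot _ _ FY FZ; left.
      by exists Z => //; apply: span_lin => //; exact: YZ.
    by exists Y => //; apply: span_lin => //; exact: span_incl Zv.
  by left; exists Y => //; apply: span_lin => //; exact: span0.
pose u : {rmorphism A -> ring_quot X} := @qpi A X.
(* The value at 0 is forced, since [lrepr 0] may be a nonzero element of the ideal. *)
pose s (b : ring_quot X) : A := if b == 0 then 0 else lrepr b.
have su : cancel s u.
  by move=> b; rewrite /s; case: eqP => [->|_]; [exact: raddf0 | exact: lreprK].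
exists (ring_quot X), u, s; split=> //; first by rewrite /s eqxx.
  (* If [e] and [1 - e] are both nonzero, then [u x] is a multiple of each, so that
     [u x = u x * e = 0]. *)
  move=> e ee; have mult (a : A) : u a <> 0 -> exists c, u x = c * u a.
    move=> a0; have : ~ ~ @span A A^o (X `|` [set a]) x.
      apply: Xmax; split; first by move=> y; left.
      move=> H; apply: a0; apply/qpi_eq0.
      have -> : a = 1 *: (a : A^o) + 0 by rewrite scale1r addr0.
      by apply: span_lin; [apply: H; right | exact: span0].
    move=> /contrapT/span_setU1[c /qpi_eq0]; rewrite rmorphB rmorphM /= => /eqP.
    by rewrite subr_eq0 => /eqP cE; exists (u c).
  apply: contrapT => /not_orP[e0 e1].
  have [|c cE] := mult (s e); first by rewrite su.
  have [|d dE] := mult (1 - s e).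
    rewrite rmorphB rmorph1 su => /eqP; rewrite subr_eq0 eq_sym => /eqP; exact: e1.
  rewrite su in cE; rewrite rmorphB rmorph1 su in dE.
  apply: Xx; apply/qpi_eq0; rewrite -/u.
  by rewrite cE -ee mulrA -cE dE -mulrA mulrBl mul1r ee subrr mulr0.
by move=> /qpi_eq0.
Qed.

End ConnectedQuotient.

(** * Descent of continuous endomorphisms to a quotient of the coefficient ring *)

Section Descent.
Variables (A B : comPzRingType) (u : {rmorphism A -> B}) (s : B -> A).
Hypotheses (s0 : s 0 = 0) (su : cancel s u).
Variable n : nat.

(** For a fixed coefficient of the image, density reduces the claim to the monomial terms of [x];
    [phi] is linear over [A], and their coefficients are killed by [u]. *)
Lemma imap_endo_ker (phi : {rmorphism iterL A n -> iterL A n}) x :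
  cont_alg phi -> imap u n x = 0 -> imap u n (phi x) = 0.
Proof.
move=> [phiC phi_cont] ux; apply: icoef_inj_ => l; rewrite icoef_imap icoef_0.
pose T x := u (icoef_ (phi x) l).
have T_zmod : zmod_morphism T by move=> y z; rewrite /T raddfB icoefB_ raddfB.
pose Ta := GRing.isZmodMorphism.Build _ _ T T_zmod.
pose TT : {additive iterL A n -> B} := HB.pack T Ta.
have [lam lamP] := Zlam_point (- l); have [mu muP] := phi_cont lam.
apply: (@dense_eq0 _ _ _ TT mu) => [g /muP/(_ _ lamP)|m]; rewrite /= /T.
  by rewrite opprK => ->; rewrite rmorph0.
rewrite imonoE rmorphM phiC icoef_constM rmorphM -icoef_imap ux icoef_0.
by rewrite mul0r.
Qed.

(** Lift, apply [phi] and reduce; [imap_endo_ker] makes the result independent of the lift.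
    Continuity is inherited because the lift [t] keeps vanishing coefficients zero. *)
Lemma descend_endo (phi : {rmorphism iterL A n -> iterL A n}) : cont_alg phi ->
  exists phi' : {rmorphism iterL B n -> iterL B n},
    cont_alg phi' /\ forall x, phi' (imap u n x) = imap u n (phi x).
Proof.
move=> phi_ca; have [phiC phi_cont] := phi_ca.
have [t [tu tE]] := imap_section n s0 su.
pose p x := imap u n (phi (t x)).
have pE x : p (imap u n x) = imap u n (phi x).
  apply/eqP; rewrite -subr_eq0 /p -!raddfB; apply/eqP; apply: imap_endo_ker => //.
  by rewrite raddfB /= tu subrr.
have p_zmod : zmod_morphism p.
  by move=> x y; rewrite -[x]tu -[y]tu -raddfB !pE !raddfB.
have p_mon : monoid_morphism p.
  split=> [|x y]; first by have := pE 1; rewrite !rmorph1.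
  by rewrite -[x]tu -[y]tu -rmorphM !pE !rmorphM.
pose pa := GRing.isZmodMorphism.Build _ _ p p_zmod.
pose pm := GRing.isMonoidMorphism.Build _ _ p p_mon.
pose phi' : {rmorphism iterL B n -> iterL B n} := HB.pack p pa pm.
exists phi'; split; last exact: pE.
split=> [b|lam].
  rewrite -[b]su -!imono_const -imap_mono /= pE.
  by rewrite imono_const phiC.
have [mu muP] := phi_cont lam; exists mu => x xmu.
by apply: small_imap; apply: muP => l lm; rewrite tE xmu.
Qed.

End Descent.

(** * The degree of an automorphism and the invariance of the residue *)

Lemma degree_automorphism (A : comPzRingType) n
    (phi psi : {rmorphism iterL A n -> iterL A n}) :
  cont_alg phi -> cont_alg psi -> cancel phi psi -> cancel psi phi ->
  degree phi = 1.
Proof.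
move=> phi_ca psi_ca phiK psiK; apply/eqP; rewrite -subr_eq0; apply/eqP.
(* If [degree phi - 1] were nonzero, its image in some connected quotient would be nonzero too,
   contrary to [degree_connected] for the descended maps. *)
apply: contrapT => /connected_quotient[B [u [s [s0 su B_conn ux]]]].
have [t [tu _]] := imap_section n s0 su.
have [phi' [phi'_ca phi'E]] := descend_endo s0 su phi_ca.
have [psi' [psi'_ca psi'E]] := descend_endo s0 su psi_ca.
apply: ux; rewrite rmorphB rmorph1 /=; apply/eqP; rewrite subr_eq0; apply/eqP.
have -> : u (degree phi) = degree phi'.
  rewrite /degree -imap_res rmorphM rmorph_prod imap_jac; congr (res (_ * jac _)).
    by apply: eq_bigr => i _; rewrite -phi'E imap_mono rmorph1.
  by apply/funext => i /=; rewrite -phi'E imap_mono rmorph1.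
have [B0|/eqP B1] := eqVneq (1 : B) 0.
  by rewrite -[LHS]mulr1 -[RHS]mulr1 B0 !mulr0.
apply: (@degree_connected _ _ phi' psi') => // x; rewrite -[x]tu.
  by rewrite phi'E psi'E phiK.
by rewrite psi'E phi'E psiK.
Qed.

Lemma continuous_small n (A : comPzRingType) (phi : ilaurent n A -> ilaurent n A) :
  phi 0 = 0 -> continuous phi ->
  forall lam, exists mu, forall x : iterL A n, small mu x -> small lam (phi x).
Proof.
move=> phi0 phi_cont lam.
have [|mu muP] := phi_cont 0 [set g | Ulam lam g].
  by exists lam => g; rewrite /= phi0 subr0.
exists mu => x /UlamP xmu; apply/UlamP; apply: muP.
by rewrite /= subr0.
Qed.

Theorem mainTheorem7 (A : comPzRingType) (n : nat) (n_gt0 : (0 < n)%N)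
  (phi : {rmorphism ilaurent n A -> ilaurent n A})
  (phi_scalable : scalable phi) (phi_continuous : continuous phi)
  (phi_invertible : exists psi : {rmorphism ilaurent n A -> ilaurent n A},
     [/\ scalable psi, continuous psi, cancel phi psi & cancel psi phi])
  (omega : tform n A) :
  tres (tform_map phi omega) = tres omega.
Proof.
have [psi [psi_scalable psi_continuous phiK psiK]] := phi_invertible.
have alg (f : {rmorphism ilaurent n A -> ilaurent n A}) : scalable f ->
    continuous f -> cont_alg (f : {rmorphism iterL A n -> iterL A n}).
  move=> fZ f_cont; split=> [a|]; last exact: continuous_small (rmorph0 f) f_cont.
  have := fZ a 1; rewrite rmorph1 => E.
  have aE : a *: (1 : ilaurent n A) = iconst_ A n a by exact: mulr1.
  by rewrite aE in E.
have phi_ca := alg _ phi_scalable phi_continuous.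
have psi_ca := alg _ psi_scalable psi_continuous.
(* The coordinate of $d\phi(t_1)\wedge\ldots\wedge d\phi(t_n)$ is a Jacobian, which turns the claim
   about forms into one about series. *)
have -> : tres (tform_map phi omega) =
    res ((phi (topcoef omega) : iterL A n) * jac ((phi : iterL A n -> iterL A n) \o @tvar A n)).
  rewrite /tres /tform_map [topcoef _]linearZ /= topcoef_wedge; congr (res (_ * \det _)).
  by apply/matrixP => i j; rewrite !mxE tcoord_td mxE /= /ivar ivar_imono.
rewrite (res_endo _ phi_ca) (degree_automorphism phi_ca psi_ca phiK psiK).
exact: mul1r.
Qed.
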